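(* Let $\alpha:(a,b)\to\mathbb{R}$ be strictly increasing, let $\beta_1,\beta_2\in \mathrm{BV}_{\rm loc}((a,b),\mathbb{R})$, and assume $\omega_1(x)\neq0$ and $\omega_2(x)\neq0$ for all $x\in(a,b)$. Let $u$ and $v$ be nontrivial real-valued balanced solutions on $(a,b)$ of $-d(dy/d\alpha)+y\,d\beta_1=0$ and $-d(dy/d\alpha)+y\,d\beta_2=0$, respectively. Let $s<t$ be consecutive points in $\mathcal{Z}_{(a,b)}(u)$. (1) If $u^+(s)=u^-(t)=0$ and $d(\beta_1-\beta_2)$ is a nontrivial positive measure on $(s,t)$, then $v$ changes sign in $(s,t)$. (2) If $u^-(s)=u^-(t)=0$, $\omega_1(s)>0$, and $d(\beta_1-\beta_2)$ is a positive measure on $[s,t)$, then $v$ changes sign in $[s,t)$. (3) If $u^+(s)=u^+(t)=0$, $\omega_1(t)>0$, and $d(\beta_1-\beta_2)$ is a positive measure on $(s,t]$, then $v$ changes sign in $(s,t]$. (4) If $u^-(s)=u^+(t)=0$, $\omega_1(s)>0$, $\omega_1(t)>0$, and $d(\beta_1-\beta_2)$ is a positive measure on $[s,t]$, then $v$ changes sign in $[s,t]$.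
   Context: Throughout $-\infty\le a<b\le\infty$. $\mathrm{BV}_{\rm loc}((a,b),\mathbb{C})$ (resp. $\mathrm{BV}_{\rm loc}((a,b),\mathbb{R})$) is the space of complex-valued (resp. real-valued) functions of locally bounded variation on $(a,b)$. For such $f$: $f^-(x)=\lim_{t\uparrow x}f(t)$, $f^+(x)=\lim_{t\downarrow x}f(t)$; $df$ is the locally finite complex Borel measure on $(a,b)$ generated by $f$ (so $df([x,y))=f^-(y)-f^-(x)$ for $x<y$ in $(a,b)$); $\Delta_{df}(x)=df(\{x\})=f^+(x)-f^-(x)$. For $h$ locally integrable with respect to the total variation of $df$, $h\,df$ is the measure with density $h$ with respect to $df$. ''Positive measure'' means nonnegative measure (possibly zero); ''nontrivial'' means not the zero measure. For $j=1,2$, $\omega_j(x)=1-\tfrac14\Delta_{d\alpha}(x)\Delta_{d\beta_j}(x)$, $x\in(a,b)$. A function $f$ is balanced if $f\in \mathrm{BV}_{\rm loc}((a,b),\mathbb{C})$ and $f(x)=\tfrac12(f^-(x)+f^+(x))$ for all $x\in(a,b)$. A function $u$ is a balanced solution of $-d(dy/d\alpha)+y\,d\beta=0$ on $(a,b)$ if $u$ is balanced, $du\ll d\alpha$ (locally), the Radon–Nikodym derivative $du/d\alpha$ is balanced (i.e. has a balanced representative, which is then unique because $\alpha$ is strictly increasing, and $du/d\alpha$ denotes that representative), and $-d(du/d\alpha)+u\,d\beta=0$ as measures. Nontrivial means not identically zero. For $f\in \mathrm{BV}_{\rm loc}((a,b),\mathbb{R})$ and a subinterval $I\subset(a,b)$,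 $\mathcal{Z}_I(f)=\{x\in I: f^-(x)f^+(x)\le0\}$. Points $s<t$ of $\mathcal{Z}_{(a,b)}(u)$ are consecutive if $\mathcal{Z}_{(a,b)}(u)\cap(s,t)=\emptyset$. A nontrivial real-valued balanced solution $w$ changes sign at $x_0\in(a,b)$ if there is $\delta>0$ such that $w^-<0$ on $(x_0-\delta,x_0)$ and $w^+>0$ on $(x_0,x_0+\delta)$, or $w^->0$ on $(x_0-\delta,x_0)$ and $w^+<0$ on $(x_0,x_0+\delta)$. It changes sign in a subinterval $I$ of $(a,b)$ if it changes sign at some point of $I$. *)

(* Defs.v *)
From HB Require Import structures.
From mathcomp Require Import all_boot all_order all_algebra.
From mathcomp Require Import complex.
From mathcomp Require Import all_classical all_reals all_analysis.
From mathcomp Require Import lra.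

Set Implicit Arguments.
Unset Strict Implicit.
Unset Printing Implicit Defensive.

Import Order.TTheory GRing.Theory Num.Theory.
Import numFieldNormedType.Exports.

Local Open Scope classical_set_scope.
Local Open Scope ring_scope.
Local Open Scope complex_scope.

(* The interval (a, b) has extended real endpoints; a function on (a, b) is a
   total function on R whose values outside (a, b) are never used. *)
Definition oitv (R : realType) (a b : \bar R) : set R :=
  [set x | (a < x%:E < b)%E].

Section locally_bounded_variation.
Context {R : realType}.
Implicit Types (a b : \bar R) (f : R -> R) (g : R -> R[i]) (x : R).

Definition bv_loc a b f : Prop :=
  forall c d : R, oitv a b c -> oitv a b d -> c <= d -> bounded_variation c d f.

Definition left_lim f x : R := lim (f t @[t --> x^'-]).
Definition right_lim f x : R := lim (f t @[t --> x^'+]).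
Definition jump f x : R := right_lim f x - left_lim f x.

Definition re_fun g : R -> R := fun x => complex.Re (g x).
Definition im_fun g : R -> R := fun x => complex.Im (g x).

Definition bv_locC a b g : Prop :=
  bv_loc a b (re_fun g) /\ bv_loc a b (im_fun g).

Definition left_limC g x : R[i] :=
  left_lim (re_fun g) x +i* left_lim (im_fun g) x.
Definition right_limC g x : R[i] :=
  right_lim (re_fun g) x +i* right_lim (im_fun g) x.

Definition balanced a b g : Prop :=
  bv_locC a b g /\
  forall x, oitv a b x -> g x = (left_limC g x + right_limC g x) / 2%:R.

End locally_bounded_variation.

(* df is only locally finite on (a, b), hence not a charge in general.  It is
   handled through its restrictions to the windows [c, d) with c < d in (a, b),
   which are finite and which exhaust the relatively compact Borel subsets of
   (a, b). *)
Section stieltjes.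
Context {R : realType}.
Local Notation T := (measurableTypeR R).
Implicit Types (f : R -> R) (c d : R) (nu : {charge set T -> \bar R}).

Definition generates f c d nu : Prop :=
  (forall x y, c <= x -> x <= y -> y <= d ->
     nu `[x, y[%classic = (left_lim f y - left_lim f x)%:E) /\
  (forall A : set T, measurable A -> nu A = nu (A `&` `[c, d[)).

(* The restriction of df to [c, d).  For f locally of bounded variation it
   exists (stieltjesP) and its values on Borel sets are unique, since the
   intervals [x, y) form a pi-system; czero is a junk value for other f. *)
Definition stieltjes f c d : {charge set T -> \bar R} :=
  if pselect (exists nu, generates f c d nu) is left h
  then projT1 (cid h) else czero.

Definition hahn_pos nu : set T := projT1 (cid (Hahn_decomposition nu)).
Definition hahn_neg nu : set T :=
  projT1 (cid (projT2 (cid (Hahn_decomposition nu)))).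
Definition hahnP nu : hahn_decomposition nu (hahn_pos nu) (hahn_neg nu) :=
  projT2 (cid (projT2 (cid (Hahn_decomposition nu)))).

Definition charge_integral nu (A : set T) (h : R -> R) : R :=
  \int[jordan_pos (hahnP nu)]_(x in A) h x -
  \int[jordan_neg (hahnP nu)]_(x in A) h x.

End stieltjes.

(* Existence of the measure generated by a function of locally bounded
   variation: stieltjesP, below, from the nondecreasing case. *)
Section nondecreasing_stieltjes.
Context {R : realType} (h : R -> R).
Context (hnd : forall x y, x <= y -> h x <= h y).

Let U (x : R) : set R := [set h t | t in [set t | x < t]].
Let D (x : R) : set R := [set h t | t in [set t | t < x]].
Definition mono_right (x : R) : R := inf (U x).
Definition mono_left (x : R) : R := sup (D x).

Let U0 x : has_inf (U x).
Proof.
split; first by exists (h (x + 1)), (x + 1) => //=; lra.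
by exists (h x) => _ [t /= xt <-]; apply/hnd/ltW.
Qed.
Let D0 x : has_sup (D x).
Proof.
split; first by exists (h (x - 1)), (x - 1) => //=; lra.
by exists (h x) => _ [t /= xt <-]; apply/hnd/ltW.
Qed.

Lemma mono_right_ge x : h x <= mono_right x.
Proof.
by apply: lb_le_inf; [exact: (U0 x).1|move=> _ [t /= xt <-]; exact/hnd/ltW].
Qed.
Lemma mono_right_le x y : x < y -> mono_right x <= h y.
Proof. by move=> xy; apply: ge_inf; [exact: (U0 x).2|exists y]. Qed.
Lemma mono_left_ge x y : x < y -> h x <= mono_left y.
Proof. by move=> xy; apply: ub_le_sup; [exact: (D0 y).2|exists x]. Qed.

Lemma mono_right_nd : {homo mono_right : x y / x <= y}.
Proof.
move=> x y; rewrite le_eqVlt => /predU1P[->//|xy].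
exact: le_trans (mono_right_le xy) (mono_right_ge y).
Qed.

Lemma mono_right_rc : right_continuous mono_right.
Proof.
move=> x; apply/cvgrPdist_lt => e e0.
have [_ [t /= xt <-] te] := inf_adherent e0 (U0 x).
near=> y.
have xy : x < y by near: y; exact: nbhs_right_gt.
have yt : y < t by near: y; exact: nbhs_right_lt.
rewrite distrC ger0_norm ?subr_ge0; last exact/mono_right_nd/ltW.
rewrite ltrBlDl; apply: le_lt_trans te; exact: mono_right_le.
Unshelve. all: by end_near. Qed.

HB.instance Definition _ := isCumulative.Build R _ R mono_right mono_right_nd mono_right_rc.

Lemma mono_cvg_left y : h t @[t --> y^'-] --> mono_left y.
Proof.
apply/cvgrPdist_lt => e e0.
have [_ [t /= ty <-] te] := sup_adherent e0 (D0 y).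
near=> z.
have zy : z < y by near: z; exact: nbhs_left_lt.
have tz : t < z by near: z; exact: nbhs_left_gt.
rewrite ger0_norm ?subr_ge0; last exact: mono_left_ge.
have := hnd (ltW tz); rewrite -/(mono_left y) in te; lra.
Unshelve. all: by end_near. Qed.

Lemma mono_right_cvg_left y : mono_right t @[t --> y^'-] --> mono_left y.
Proof.
apply/cvgrPdist_lt => e e0.
have [_ [t /= ty <-] te] := sup_adherent e0 (D0 y).
near=> z.
have zy : z < y by near: z; exact: nbhs_left_lt.
have tz : t < z by near: z; exact: nbhs_left_gt.
have zm : z < (z + y) / 2 by lra.
have my : (z + y) / 2 < y by lra.
have := mono_right_le zm; have := mono_left_ge my; have := mono_right_ge z; have := hnd (ltW tz).
rewrite -/(mono_left y) in te => *.
by rewrite ger0_norm; lra.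
Unshelve. all: by end_near. Qed.

Let mu : {measure set (measurableTypeR R) -> \bar R} := lebesgue_stieltjes_measure (mono_right : cumulative R R).

Lemma mono_mu_oc x y : x <= y -> mu `]x, y]%classic = (mono_right y - mono_right x)%:E.
Proof.
move=> xy; rewrite /mu /= /lebesgue_stieltjes_measure /measure_extension measurable_mu_extE/=; last exact: is_ocitv.
by rewrite wlength_itv_bnd.
Qed.

Lemma mono_mu_oo x y : x < y -> mu `]x, y[%classic = (mono_left y - mono_right x)%:E.
Proof.
move=> xy.
pose u (n : nat) : R := y - (y - x) * n.+1%:R^-1.
have upos n : 0 < (y - x) * n.+1%:R^-1 by rewrite mulr_gt0 ?subr_gt0.
have uy n : u n < y by rewrite /u ltrBlDr ltrDl.
have ux n : x <= u n.
  have : (y - x) * n.+1%:R^-1 <= y - x.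
    by rewrite ger_pMr ?subr_gt0// invf_le1// ler1n.
  by rewrite /u lerBrDr addrC -lerBrDr.
have ucv : u n @[n --> \oo] --> y.
  rewrite -[X in _ --> X]subr0 -[X in _ - X](mulr0 (y - x)).
  apply: cvgB; first exact: cvg_cst.
  by apply: cvgMl_tmp; exact: cvg_harmonic.
have eqU : `]x, y[%classic = \bigcup_n `]x, u n]%classic.
  apply/seteqP; split => [z /=|z [n _]/=]; rewrite !in_itv/= => /andP[xz zy].
    have : \forall n \near \oo, z < u n.
      by move/cvgr_gt : ucv; apply.
    by move=> [n _ /(_ n (leqnn _))] zn; exists n => //=; rewrite in_itv/= xz ltW.
  by rewrite xz/= (le_lt_trans zy).
have H1 : (mu \o (fun n => `]x, u n]%classic)) n @[n --> \oo] --> mu (\bigcup_n `]x, u n]%classic).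
  apply: nondecreasing_cvg_mu.
  - by move=> i; exact: measurable_itv.
  - by rewrite -eqU; exact: measurable_itv.
  - move=> m n mn; apply/subsetPset => z /=; rewrite !in_itv/= => /andP[-> zm].
    apply: (le_trans zm); rewrite /u lerB// ler_pM2l ?subr_gt0//.
    by rewrite lef_pV2 ?posrE// ler_nat.
have H2 : (mu \o (fun n => `]x, u n]%classic)) n @[n --> \oo] --> (mono_left y - mono_right x)%:E.
  have -> : mu \o (fun n => `]x, u n]%classic) = fun n => (mono_right (u n) - mono_right x)%:E.
    by apply/funext => n /=; rewrite mono_mu_oc.
  apply: cvg_EFin; first by near=> n.
  apply: cvgB; last exact: cvg_cst.
  by have /cvg_at_leftP := @mono_right_cvg_left y; apply.
rewrite eqU; exact: (cvg_unique _ H1 H2).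
Unshelve. all: by end_near. Qed.

Lemma mono_mu_co x y : x <= y -> mu `[x, y[%classic = (mono_left y - mono_left x)%:E.
Proof.
move=> xy.
have x1 : x - 1 < x by lra.
have y1 : x - 1 < y by lra.
have -> : `[x, y[%classic = `]x - 1, y[%classic `\` `]x - 1, x[%classic.
  apply/seteqP; split => z /=; rewrite !in_itv/=.
    by move=> /andP[xz zy]; split; lra.
  by move=> [/andP[-> ->]] /=; rewrite andbT leNgt => /negP.
have h1 := mono_mu_oo y1; have h2 := mono_mu_oo x1.
pose I1 : set (measurableTypeR R) := `]x - 1, y[%classic.
pose I2 : set (measurableTypeR R) := `]x - 1, x[%classic.
transitivity (mu I1 - mu (I1 `&` I2))%E.
  apply: measureD; [exact: measurable_itv|exact: measurable_itv|].
  by rewrite /I1 [X in (X < _)%E](h1 : _ = _) ltry.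
have -> : I1 `&` I2 = I2.
  rewrite /I1 /I2; apply/seteqP; split => z /=; rewrite !in_itv/=; first by case.
  by move=> zz; split => //; lra.
by rewrite h1 h2 -EFinB; congr EFin; lra.
Qed.

Lemma generates_nondecreasing (c d : R) : c <= d ->
  exists nu : {charge set (measurableTypeR R) -> \bar R}, generates h c d nu.
Proof.
move=> cd.
have mD : measurable (`[c, d[%classic : set (measurableTypeR R)).
  exact: measurable_itv.
have Doo : (mu `[c, d[%classic < +oo)%E by rewrite mono_mu_co// ltry.
exists (charge_of_finite_measure (mfrestr mD Doo)); split.
- move=> x y cx xy yd.
  rewrite /charge_of_finite_measure /= /mfrestr /= /mrestr.
  rewrite (_ : _ `&` _ = `[x, y[%classic) -/mu; last first.
    apply/seteqP; split => z /=; rewrite !in_itv/=; first by case.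
    by move=> zz; split => //; lra.
  rewrite mono_mu_co//; congr (_ - _)%:E.
  - by apply/esym/cvg_lim => //; exact: mono_cvg_left.
  - by apply/esym/cvg_lim => //; exact: mono_cvg_left.
- move=> A mA; rewrite /charge_of_finite_measure /= /mfrestr /= /mrestr.
  by rewrite -setIA setIid.
Qed.
Lemma is_cvg_mono_left y : cvg (h t @[t --> y^'-]).
Proof. by apply/cvg_ex; exists (mono_left y); exact: mono_cvg_left. Qed.

End nondecreasing_stieltjes.

Lemma stieltjesP (R : realType) (a b : \bar R) (f : R -> R) (c d : R) :
  bv_loc a b f -> oitv a b c -> oitv a b d -> c < d ->
  generates f c d (stieltjes f c d).
Proof.
move=> bvf /andP[ac cb] /andP[ad db] cd.
suff : exists nu, generates f c d nu.
  by move=> H; rewrite /stieltjes; case: pselect => // h; case: cid.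
have [c' c'c oc'] : exists2 c', c' < c & (a < c'%:E)%E.
  case: a ac {ad bvf} => [r| |]//=.
  - by rewrite lte_fin => rc; exists ((r + c) / 2); rewrite ?lte_fin; lra.
  - by move=> _; exists (c - 1); [lra|rewrite ltNyr].
pose p x := Num.max c' (Num.min x d).
have p1 x : c' <= p x by rewrite /p le_max lexx.
have p2 x : p x <= d by rewrite /p ge_max ge_min lexx orbT andbT; lra.
have p3 x y : x <= y -> p x <= p y.
  by move=> xy; rewrite /p le_max2 // le_min2.
have p4 x : c' <= x -> x <= d -> p x = x.
  by move=> c'x xd; rewrite /p min_l// max_r.
have bv : bounded_variation c' d f.
  apply: bvf; last lra; apply/andP; split => //.
    by apply: lt_trans cb; rewrite lte_fin.
have bvN : bounded_variation c' d (\- f) by apply/bounded_variationN.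
pose f1 := (fine \o pos_tv c' f) \o p.
pose f2 := (fine \o neg_tv c' f) \o p.
have nd1 x y : x <= y -> f1 x <= f1 y.
  move=> xy; apply: (fine_neg_tv_nondecreasing bvN); last exact: p3.
  - by rewrite in_itv/= p1 p2.
  - by rewrite in_itv/= p1 p2.
have nd2 x y : x <= y -> f2 x <= f2 y.
  move=> xy; apply: (fine_neg_tv_nondecreasing bv); last exact: p3.
  - by rewrite in_itv/= p1 p2.
  - by rewrite in_itv/= p1 p2.
have fE x : c' <= x -> x <= d -> f x = f1 x - f2 x.
  move=> h1 h2; rewrite (bounded_variation_pos_neg_tvE bv) ?in_itv/= ?h1//.
  by rewrite /f1 /f2 /= p4.
have [n1 [n1a n1b]] := generates_nondecreasing nd1 (ltW cd).
have [n2 [n2a n2b]] := generates_nondecreasing nd2 (ltW cd).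
have limE x : c <= x -> x <= d -> left_lim f x = left_lim f1 x - left_lim f2 x.
  move=> cx xd; apply/cvg_lim => //.
  have : (f1 t - f2 t) @[t --> x^'-] --> left_lim f1 x - left_lim f2 x.
    by apply: cvgB; exact: is_cvg_mono_left.
  apply: cvg_trans; apply: near_eq_cvg; near=> t.
  rewrite fE//.
  - by near: t; apply: nbhs_left_ge; lra.
  - apply: (@le_trans _ _ x) => //; near: t; exact: nbhs_left_le.
exists (cadd n1 (copp n2)); split.
- move=> x y cx xy yd; rewrite !limE; [|lra..].
  transitivity (n1 `[x, y[%classic + - n2 `[x, y[%classic)%E; first by [].
  rewrite (n1a x y cx xy yd) (n2a x y cx xy yd).
  by rewrite -EFinB; congr EFin; lra.
- move=> A mA.
  transitivity (n1 A + - n2 A)%E; first by [].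
  by rewrite (n1b A mA) (n2b A mA).
Unshelve. all: by end_near. Qed.

Section solutions.
Context {R : realType}.
Local Notation T := (measurableTypeR R).
Implicit Types (a b : \bar R) (alpha beta f : R -> R) (y g h : R -> R[i]).
Implicit Types (c d : R) (I A : set T).

Definition in_window a b c d A : Prop :=
  [/\ oitv a b c, oitv a b d, c < d, measurable A & A `<=` `[c, d[].

Definition stieltjesC g c d A : R[i] :=
  fine (stieltjes (re_fun g) c d A) +i* fine (stieltjes (im_fun g) c d A).

(* value on A of the measure h df, for complex h and real f *)
Definition densityC h f c d A : R[i] :=
  charge_integral (stieltjes f c d) A (re_fun h) +i*
  charge_integral (stieltjes f c d) A (im_fun h).

Definition abs_cont a b g alpha : Prop :=
  forall c d, oitv a b c -> oitv a b d -> c < d ->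
    stieltjes (re_fun g) c d `<< stieltjes alpha c d /\
    stieltjes (im_fun g) c d `<< stieltjes alpha c d.

Definition RN_derivative a b g alpha h : Prop :=
  forall c d A, in_window a b c d A ->
    stieltjesC g c d A = densityC h alpha c d A.

Definition balanced_solution a b alpha beta y : Prop :=
  [/\ balanced a b y,
      abs_cont a b y alpha
    & exists dy, [/\ balanced a b dy,
        RN_derivative a b y alpha dy
      & forall c d A, in_window a b c d A ->
          - stieltjesC dy c d A + densityC y beta c d A = 0]].

(* The function u is real-valued; its derivative with respect to alpha is only required to
   be a complex-valued balanced function. *)
Definition real_balanced_solution a b alpha beta (u : R -> R) : Prop :=
  balanced_solution a b alpha beta (fun x => (u x)%:C).

Definition nontrivial a b (u : R -> R) : Prop :=
  exists2 x, oitv a b x & u x != 0.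

Definition positive_on a b f I : Prop :=
  forall c d A, in_window a b c d A -> A `<=` I -> (0 <= stieltjes f c d A)%E.

Definition nontrivial_on a b f I : Prop :=
  exists c d A, [/\ in_window a b c d A, A `<=` I & stieltjes f c d A != 0%E].

Definition omega alpha beta x : R :=
  1 - 4%:R^-1 * jump alpha x * jump beta x.

Definition zero_set I f : set R :=
  [set x | I x /\ left_lim f x * right_lim f x <= 0].

Definition consecutive_zeros a b f (s t : R) : Prop :=
  [/\ s < t, zero_set (oitv a b) f s, zero_set (oitv a b) f t
    & zero_set (oitv a b) f `&` `]s, t[ = set0].

Definition changes_sign_at a b f x0 : Prop :=
  oitv a b x0 /\
  exists2 delta : R, 0 < delta &
    `]x0 - delta, x0 + delta[ `<=` oitv a b /\
    (((forall x, x0 - delta < x < x0 -> left_lim f x < 0) /\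
      (forall x, x0 < x < x0 + delta -> 0 < right_lim f x)) \/
     ((forall x, x0 - delta < x < x0 -> 0 < left_lim f x) /\
      (forall x, x0 < x < x0 + delta -> right_lim f x < 0))).

Definition changes_sign_in a b f I : Prop :=
  exists2 x0, I x0 & changes_sign_at a b f x0.

End solutions.

(* Main.v *)
(* Write [p] and [q] for the derivatives of [u] and [v] with respect to [alpha].
   The Wronskian [W = u q - v p] satisfies [dW = - u v d(beta1 - beta2)], so it is
   nonincreasing wherever [u v] is nonnegative and [d(beta1 - beta2)] is positive.
   If [v] had no sign change, one could take [u] and [v] positive between [s]
   and [t]; the boundary values of [u] then give [W] a sign at [s] and the opposite
   one at [t].  Hence [W] vanishes at both ends, which forces [v = 0] at a closed
   end, where the condition on [omega] makes [v] change sign, or, in the open case,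
   [W = 0] throughout and so [d(beta1 - beta2) = 0].

   The equation for [dW] is replaced by a local estimate: right of every point,
   the increments of [W] and of [beta1 - beta2] match up to [e] times those of a fixed
   monotone function.  Real induction turns it into monotonicity; the jumps are
   exact identities. *)
Require Import Defs.
From HB Require Import structures.
From mathcomp Require Import all_boot all_order all_algebra.
From mathcomp Require Import complex.
From mathcomp Require Import all_classical all_reals all_analysis.
From mathcomp Require Import measurable_realfun ring lra.

Import Order.TTheory GRing.Theory Num.Theory.
Import numFieldNormedType.Exports.

Local Open Scope classical_set_scope.
Local Open Scope ring_scope.

(** * Charges and their variation *)

Section charges.
Context {R : realType}.
Local Notation T := (measurableTypeR R).
Implicit Types (nu : {charge set T -> \bar R}) (f h : R -> R) (A : set T).

(** A single point may carry atoms of [d alpha], [d beta1] and [d beta2] at once, so [u] and [p]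
    jump together and the product rule for [u q - v p] needs care. At an atom it is exact because
    values are means of one-sided limits. Between atoms, integrals are only compared with constants:
    where the integrand is within [M] of [k], the increment is [k] times that of the generator, up
    to [M] times its variation. Nearly everything is phrased with left limits, since the measures
    are prescribed on intervals [[x, y[]. The number [omega] is the determinant of the linear system
    that carries [(u^-, p^-)] to [(u^+, p^+)]. Being nonzero, it lets vanishing data cross a jump in
    both directions, whence uniqueness: at a zero of a one-sided limit of a nontrivial solution, the
    same limit of the derivative is nonzero and decides the sign beside the point. Its positivity
    matters at a closed end, and passes from the first equation to the second because the atoms of
    [d alpha] and [d(beta1 - beta2)] there are nonnegative. *)

Definition chargeV nu A : R :=
  fine (jordan_pos (hahnP nu) A) + fine (jordan_neg (hahnP nu) A).

Lemma fine_chargeE nu A : measurable A -> fine (nu A) =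
  fine (jordan_pos (hahnP nu) A) - fine (jordan_neg (hahnP nu) A).
Proof.
move=> mA; rewrite (jordan_decomp (hahnP nu) mA) /cadd/= cscaleN1.
by rewrite fineD ?fineN ?fin_numN ?fin_num_measure.
Qed.

Lemma charge_nondecreasing_cvg nu (F : (set T)^nat) :
  (forall i, measurable (F i)) -> nondecreasing_seq F ->
  fine (nu (F n)) @[n --> \oo] --> fine (nu (\bigcup_n F n)).
Proof.
move=> mF ndF.
have mU : measurable (\bigcup_n F n) by exact: bigcup_measurable.
rewrite fine_chargeE//.
under eq_fun do rewrite fine_chargeE//.
apply: cvgB; apply: fine_cvg; rewrite fineK ?fin_num_measure//;
  exact: nondecreasing_cvg_mu.
Qed.

Lemma charge_bigcup_eq0 nu (F : (set T)^nat) :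
  (forall i, measurable (F i)) -> nondecreasing_seq F ->
  (forall n, nu (F n) = 0%E) -> nu (\bigcup_n F n) = 0%E.
Proof.
move=> mF ndF F0; have := charge_nondecreasing_cvg nu F mF ndF.
under eq_fun do rewrite F0.
move=> /(cvg_lim (@Rhausdorff R)); rewrite lim_cst// => F0'.
by rewrite -[LHS]fineK -?F0'// fin_num_measure//; exact: bigcup_measurable.
Qed.

Lemma Rintegral_near_cst (mu : {finite_measure set T -> \bar R}) A h (k M : R) :
  measurable A -> measurable_fun A h -> (forall x, A x -> `|h x - k| <= M) ->
  `|\int[mu]_(x in A) h x - k * fine (mu A)| <= M * fine (mu A).
Proof.
move=> mA mh hM.
have muA : (mu A < +oo)%E by rewrite ltey_eq fin_num_measure.
have ih : mu.-integrable A (EFin \o h).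
  apply: measurable_bounded_integrable => //.
  exists (`|k| + M); split; first exact: num_real.
  move=> K KM x Ax /=; apply: le_trans (ltW KM).
  by rewrite -[h x](subrK k) (le_trans (ler_normD _ _))// addrC lerD2l hM.
have ic (c : R) : mu.-integrable A (EFin \o cst c) by exact: finite_measure_integrable_cst.
rewrite -(@Rintegral_cst _ _ _ mu _ mA k) -(@Rintegral_cst _ _ _ mu _ mA M).
rewrite -RintegralB//; last exact: (ic k).
have iB : mu.-integrable A (EFin \o (fun x => h x - k)).
  exact: (integrableB mA ih (ic k)).
apply: le_trans (le_normr_Rintegral mA iB) _.
apply: le_Rintegral => //; last exact: (ic M).
  by have := integrable_norm iB.
Qed.

(** The errors on the two Jordan parts add up, so the bound involves the variation [chargeV] and not
    [nu]. Integrals against charges enter the proof through this estimate alone. *)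
Lemma charge_integral_near_cst nu A h (k M : R) :
  measurable A -> measurable_fun A h -> (forall x, A x -> `|h x - k| <= M) ->
  `|charge_integral nu A h - k * fine (nu A)| <= M * chargeV nu A.
Proof.
move=> mA mh hM; rewrite /charge_integral /chargeV fine_chargeE//.
have := Rintegral_near_cst (jordan_pos (hahnP nu)) A h k M mA mh hM.
have := Rintegral_near_cst (jordan_neg (hahnP nu)) A h k M mA mh hM.
set p := fine (jordan_pos _ _); set n := fine (jordan_neg _ _).
rewrite !ler_norml => /andP[? ?] /andP[? ?].
by apply/andP; split; lra.
Qed.

Lemma charge_integral_set1 nu h (x : R) :
  charge_integral nu [set x] h = h x * fine (nu [set x]).
Proof.
apply/eqP; rewrite -subr_eq0 -normr_le0.
have := @charge_integral_near_cst nu [set x] h (h x) 0; rewrite mul0r; apply.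
- exact: measurable_set1.
- exact: measurable_fun_set1.
- by move=> _ ->; rewrite subrr normr0.
Qed.

Lemma le_norm_chargeV nu A : measurable A -> `|fine (nu A)| <= chargeV nu A.
Proof.
move=> mA; rewrite fine_chargeE// /chargeV ler_norml.
have p : 0 <= fine (jordan_pos (hahnP nu) A) by exact: fine_ge0.
have n : 0 <= fine (jordan_neg (hahnP nu) A) by exact: fine_ge0.
by apply/andP; split; lra.
Qed.

Lemma chargeVU nu A B : measurable A -> measurable B -> A `&` B = set0 ->
  chargeV nu (A `|` B) = chargeV nu A + chargeV nu B.
Proof.
move=> mA mB AB; rewrite /chargeV !measureU// !fineD ?fin_num_measure//.
by rewrite addrACA.
Qed.

Lemma chargeV_itv nu (c x y : R) : c <= x -> x <= y ->
  chargeV nu `[c, y[ - chargeV nu `[c, x[ = chargeV nu `[x, y[.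
Proof.
move=> cx xy; have <- : `[c, x[%classic `|` `[x, y[%classic = `[c, y[%classic :> set T.
  apply/seteqP; split => z /=; rewrite !in_itv/=.
    by move=> [|] /andP[? ?]; apply/andP; split; lra.
  by move=> /andP[cz zy]; have [xz|zx] := leP x z; [right|left]; rewrite ?zy ?cz.
rewrite chargeVU; [|exact: measurable_itv|exact: measurable_itv|].
  by rewrite addrC addKr.
apply/seteqP; split => z //=; rewrite !in_itv/= => -[/andP[? ?] /andP[? ?]]; lra.
Qed.

(** [jordan_neg] of [A] is minus the charge of the trace of [A] on the negative Hahn set, hence at
    most 0. For [d alpha] the error in [charge_integral_near_cst] thus becomes an increment of
    [alpha] itself. *)
Lemma charge_ge0_chargeV nu A : measurable A ->
  (forall B, measurable B -> (0 <= nu B)%E) -> chargeV nu A = fine (nu A).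
Proof.
move=> mA nu0; rewrite fine_chargeE// /chargeV.
suff -> : jordan_neg (hahnP nu) A = 0%E by rewrite /= addr0 subr0.
apply/eqP; rewrite eq_le measure_ge0 andbT.
rewrite jordan_negE cjordan_negE leeNl oppe0 /crestr0 mem_set// /crestr.
apply: nu0; apply: measurableI => //.
by have [_ [? _] _ _] := hahnP nu.
Qed.

(** Rays are stable under intersection and generate the Borel sets, so Dynkin induction applies; the
    whole line is not a ray and is reached as an increasing union of rays. *)
Lemma charge_eq0 nu : (forall x, nu `[x, +oo[%classic = 0%E) ->
  forall A, measurable A -> nu A = 0%E.
Proof.
move=> nu0 A mA.
have mG : (@measurable _ T) = <<s @RGenCInfty.G R >>.
  exact: RGenCInfty.measurableE.
have nT : nu setT = 0%E.
  have eqU : [set: T] = \bigcup_n (`[- n%:R, +oo[%classic : set T).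
    apply/seteqP; split => // z _.
    have zn := archi_boundP (normr_ge0 z).
    exists (Num.bound `|z|) => //=; rewrite in_itv/= andbT lerNl.
    by apply: le_trans (ltW zn); rewrite -normrN ler_norm.
  rewrite eqU; apply: charge_bigcup_eq0 => [i|m n mn|//].
    exact: measurable_itv.
  apply/subsetPset => z /=; rewrite !in_itv/= !andbT; apply: le_trans.
  by rewrite lerN2 ler_nat.
apply: (dynkin_induction (P := fun A => nu A = 0%E) mG) => //.
- move=> _ _ [x ->] [y ->]; exists (Num.max x y).
  by apply/seteqP; split => z /=; rewrite !in_itv/= !andbT ge_max => /andP.
- by move=> _ [x ->].
- move=> S mS S0; rewrite -setTD.
  by rewrite (chargeD nu measurableT mS) setTI nT S0 sube0.
- move=> F mF tF F0.
  have /cvg_unique := @charge_semi_sigma_additive _ _ _ nu F mF tF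
    (bigcup_measurable (fun i _ => mF i)).
  apply => //; apply: cvg_near_cst; apply: nearW => n; exact: big1.
- by rewrite -mG.
Qed.

End charges.

(** * One-sided limits *)

Section one_sided_limits.
Context {R : realType}.
Implicit Types (a b : \bar R) (f g h : R -> R) (c d x y z : R).

Lemma near_rightP x (P : set R) : (\forall z \near x^'+, P z) <->
  exists2 e, 0 < e & forall z, x < z < x + e -> P z.
Proof.
split=> [[e /= e0 he]|[e e0 he]].
  exists e => // z /andP[xz ze]; apply: he => //=.
  by rewrite distrC gtr0_norm ?subr_gt0// ltrBlDl.
near=> z; apply: he; apply/andP; split; near: z.
  exact: nbhs_right_gt.
by apply: nbhs_right_lt; rewrite ltrDl.
Unshelve. all: by end_near. Qed.

Lemma near_leftP x (P : set R) : (\forall z \near x^'-, P z) <->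
  exists2 e, 0 < e & forall z, x - e < z < x -> P z.
Proof.
split=> [[e /= e0 he]|[e e0 he]].
  exists e => // z /andP[xz zx]; apply: he => //=.
  by rewrite gtr0_norm ?subr_gt0// ltrBlDr -ltrBlDl.
near=> z; apply: he; apply/andP; split; near: z.
  by apply: nbhs_left_gt; rewrite gtrBl.
exact: nbhs_left_lt.
Unshelve. all: by end_near. Qed.

Lemma oitv_cc a b c d x : oitv a b c -> oitv a b d -> c <= x <= d -> oitv a b x.
Proof.
move=> /andP[ac _] /andP[_ db] /andP[cx xd]; apply/andP; split.
  by apply: lt_le_trans ac _; rewrite lee_fin.
by apply: le_lt_trans db; rewrite lee_fin.
Qed.

Lemma oitv_right a b x : oitv a b x -> exists2 d, x < d & oitv a b d.
Proof.
move=> /andP[ax xb].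
have [d xd db] : exists2 d, x < d & (d%:E < b)%E.
  case: b xb => [r| |]//=.
  - by rewrite lte_fin => xr; exists ((x + r) / 2); rewrite ?lte_fin; lra.
  - by move=> _; exists (x + 1); [lra|rewrite ltry].
by exists d => //; apply/andP; split => //; apply: lt_trans ax _; rewrite lte_fin.
Qed.

Lemma oitv_left a b x : oitv a b x -> exists2 c, c < x & oitv a b c.
Proof.
move=> /andP[ax xb].
have [c cx ac] : exists2 c, c < x & (a < c%:E)%E.
  case: a ax => [r| |]//=.
  - by rewrite lte_fin => xr; exists ((x + r) / 2); rewrite ?lte_fin; lra.
  - by move=> _; exists (x - 1); [lra|rewrite ltNyr].
by exists c => //; apply/andP; split => //; apply: lt_trans xb; rewrite lte_fin.
Qed.

Lemma near_right_oitv a b x : oitv a b x -> \forall z \near x^'+, oitv a b z.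
Proof.
move=> xab; have [d xd dab] := oitv_right _ _ _ xab.
near=> z; apply: (oitv_cc _ _ _ _ _ xab dab); apply/andP; split; apply: ltW; near: z.
  exact: nbhs_right_gt.
exact: nbhs_right_lt.
Unshelve. all: by end_near. Qed.

Lemma near_left_oitv a b x : oitv a b x -> \forall z \near x^'-, oitv a b z.
Proof.
move=> xab; have [c cx cab] := oitv_left _ _ _ xab.
near=> z; apply: (oitv_cc _ _ _ _ _ cab xab); apply/andP; split; apply: ltW; near: z.
  exact: nbhs_left_gt.
exact: nbhs_left_lt.
Unshelve. all: by end_near. Qed.

(** [left_lim] and [right_lim] are values of [lim], a default when there is no limit; this predicate
    gives them their meaning. *)
Definition regulated a b f := forall x, oitv a b x ->
  cvg (f t @[t --> x^'-]) /\ cvg (f t @[t --> x^'+]).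

Section regulated_theory.
Variables (a b : \bar R) (f : R -> R).
Hypothesis rf : regulated a b f.
Variable x : R.
Hypothesis xab : oitv a b x.

Lemma cvg_left_lim : f t @[t --> x^'-] --> left_lim f x.
Proof. exact: (rf x xab).1. Qed.

Lemma cvg_right_lim : f t @[t --> x^'+] --> right_lim f x.
Proof. exact: (rf x xab).2. Qed.

End regulated_theory.

Lemma dist_left_lim f x (k e : R) : cvg (f t @[t --> x^'-]) ->
  (\forall t \near x^'-, `|f t - k| <= e) -> `|left_lim f x - k| <= e.
Proof.
move=> cf H; rewrite ler_norml lerBlDr lerBrDr; apply/andP; split.
  by apply: limr_ge => //; apply: filterS H => t; rewrite ler_norml; lra.
by apply: limr_le => //; apply: filterS H => t; rewrite ler_norml; lra.
Qed.

Lemma dist_right_lim f x (k e : R) : cvg (f t @[t --> x^'+]) ->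
  (\forall t \near x^'+, `|f t - k| <= e) -> `|right_lim f x - k| <= e.
Proof.
move=> cf H; rewrite ler_norml lerBlDr lerBrDr; apply/andP; split.
  by apply: limr_ge => //; apply: filterS H => t; rewrite ler_norml; lra.
by apply: limr_le => //; apply: filterS H => t; rewrite ler_norml; lra.
Qed.

Lemma near_nbhs_left x y : y < x -> \forall t \near x^'-, y < t < x.
Proof.
by move=> yx; near=> t; apply/andP; split; near: t;
  [exact: nbhs_left_gt|exact: nbhs_left_lt].
Unshelve. all: by end_near. Qed.

Lemma near_nbhs_right x y : x < y -> \forall t \near x^'+, x < t < y.
Proof.
by move=> yx; near=> t; apply/andP; split; near: t;
  [exact: nbhs_right_gt|exact: nbhs_right_lt].
Unshelve. all: by end_near. Qed.

Section regulated_theory.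
Variables (a b : \bar R) (f : R -> R).
Hypothesis rf : regulated a b f.

(** A bound for [f] on an open interval passes to both one-sided limits at each of its points, so
    one radius serves for the values and for the limits. *)
Lemma regulated_near_right x (e : R) : oitv a b x -> 0 < e ->
  \forall z \near x^'+, [/\ `|f z - right_lim f x| <= e,
    `|left_lim f z - right_lim f x| <= e & `|right_lim f z - right_lim f x| <= e].
Proof.
move=> xab e0.
have /near_rightP[d d0 hd] : \forall z \near x^'+, oitv a b z /\ `|f z - right_lim f x| <= e.
  apply: filterI; first exact: near_right_oitv.
  by have /cvgrPdistC_le := cvg_right_lim _ _ _ rf _ xab; exact.
apply/near_rightP; exists d => // z /andP[xz zd].
have [zab ze] : oitv a b z /\ `|f z - right_lim f x| <= e by apply: hd; rewrite xz.
split => //.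
- apply: dist_left_lim; first exact: (rf z zab).1.
  apply: filterS (near_nbhs_left _ _ xz) => t /andP[? ?].
  by apply: (hd t _).2; lra.
- apply: dist_right_lim; first exact: (rf z zab).2.
  apply: filterS (near_nbhs_right _ _ zd) => t /andP[? ?].
  by apply: (hd t _).2; lra.
Qed.

Lemma regulated_near_left x (e : R) : oitv a b x -> 0 < e ->
  \forall z \near x^'-, [/\ `|f z - left_lim f x| <= e,
    `|left_lim f z - left_lim f x| <= e & `|right_lim f z - left_lim f x| <= e].
Proof.
move=> xab e0.
have /near_leftP[d d0 hd] : \forall z \near x^'-, oitv a b z /\ `|f z - left_lim f x| <= e.
  apply: filterI; first exact: near_left_oitv.
  by have /cvgrPdistC_le := cvg_left_lim _ _ _ rf _ xab; exact.
apply/near_leftP; exists d => // z /andP[dz zx].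
have [zab ze] : oitv a b z /\ `|f z - left_lim f x| <= e by apply: hd; rewrite dz.
split => //.
- apply: dist_left_lim; first exact: (rf z zab).1.
  apply: filterS (near_nbhs_left _ _ dz) => t /andP[? ?].
  by apply: (hd t _).2; lra.
- apply: dist_right_lim; first exact: (rf z zab).2.
  apply: filterS (near_nbhs_right _ _ zx) => t /andP[? ?].
  by apply: (hd t _).2; lra.
Qed.

(** The measures see a generator only through its left limits, so a point is approached along
    [left_lim f] rather than along [f]. *)
Lemma left_lim_cvg_right x : oitv a b x ->
  left_lim f y @[y --> x^'+] --> right_lim f x.
Proof.
move=> xab; apply/cvgrPdistC_le => e e0.
by apply: filterS (regulated_near_right _ _ xab e0) => z [].
Qed.

Lemma left_lim_cvg_left x : oitv a b x ->
  left_lim f y @[y --> x^'-] --> left_lim f x.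
Proof.
move=> xab; apply/cvgrPdistC_le => e e0.
by apply: filterS (regulated_near_left _ _ xab e0) => z [].
Qed.

End regulated_theory.

Lemma regulatedN a b f : regulated a b f -> regulated a b (\- f).
Proof.
by move=> rf x xab; have [] := rf x xab; split; apply: is_cvgN.
Qed.

Lemma left_limN a b f x : regulated a b f -> oitv a b x ->
  left_lim (\- f) x = - left_lim f x.
Proof. by move=> rf xab; apply/cvg_lim => //; apply: cvgN; exact: (rf x xab).1. Qed.

Lemma right_limN a b f x : regulated a b f -> oitv a b x ->
  right_lim (\- f) x = - right_lim f x.
Proof. by move=> rf xab; apply/cvg_lim => //; apply: cvgN; exact: (rf x xab).2. Qed.

Lemma left_limB a b f g x : regulated a b f -> regulated a b g -> oitv a b x ->
  left_lim (f \- g) x = left_lim f x - left_lim g x.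
Proof.
move=> rf rg xab; apply/cvg_lim => //.
by apply: cvgB; [exact: (rf x xab).1|exact: (rg x xab).1].
Qed.

Lemma right_limB a b f g x : regulated a b f -> regulated a b g -> oitv a b x ->
  right_lim (f \- g) x = right_lim f x - right_lim g x.
Proof.
move=> rf rg xab; apply/cvg_lim => //.
by apply: cvgB; [exact: (rf x xab).2|exact: (rg x xab).2].
Qed.

Lemma nondecreasing_is_cvg_right h x : (forall y z, y <= z -> h y <= h z) ->
  cvg (h t @[t --> x^'+]).
Proof.
move=> hnd; apply: nondecreasing_at_right_is_cvgr.
  by near=> y => s t _ _; exact: hnd.
near=> y; exists (h x) => _ /= [s + <-]; rewrite in_itv/= => /andP[/ltW + _].
exact: hnd.
Unshelve. all: by end_near. Qed.

Lemma bv_loc_split a b f c d : bv_loc a b f -> oitv a b c -> oitv a b d -> c <= d ->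
  exists f1 f2, [/\ forall x y, x <= y -> f1 x <= f1 y,
    forall x y, x <= y -> f2 x <= f2 y &
    forall x, c <= x <= d -> f x = f1 x - f2 x].
Proof.
move=> bvf cab dab cd.
(* Clamping to [[c, d]] makes the two variation functions monotone on the whole line, as the limit
   lemmas for monotone functions require. *)
pose p x := Num.max c (Num.min x d).
have p1 x : c <= p x <= d by rewrite /p le_max lexx ge_max ge_min lexx orbT andbT.
have p3 x y : x <= y -> p x <= p y.
  by move=> xy; rewrite /p le_max2 // le_min2.
have p4 x : c <= x <= d -> p x = x by move=> /andP[cx xd]; rewrite /p min_l// max_r.
have bv : bounded_variation c d f by exact: bvf.
have bvN : bounded_variation c d (\- f) by apply/bounded_variationN.
exists ((fine \o pos_tv c f) \o p), ((fine \o neg_tv c f) \o p); split.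
- move=> x y xy; apply: (fine_neg_tv_nondecreasing bvN); rewrite ?in_itv/= ?p1//.
  exact: p3.
- move=> x y xy; apply: (fine_neg_tv_nondecreasing bv); rewrite ?in_itv/= ?p1//.
  exact: p3.
- move=> x cxd; rewrite (bounded_variation_pos_neg_tvE bv) ?in_itv//=.
  by rewrite p4.
Qed.

Lemma bv_loc_regulated a b f : bv_loc a b f -> regulated a b f.
Proof.
move=> bvf x xab.
have [c cx cab] := oitv_left _ _ _ xab; have [d xd dab] := oitv_right _ _ _ xab.
have [f1 [f2 [nd1 nd2 fE]]] := bv_loc_split _ _ _ _ _ bvf cab dab (ltW (lt_trans cx xd)).
split; apply/cvg_ex.
- exists (lim (f1 t @[t --> x^'-]) - lim (f2 t @[t --> x^'-])).
  have : (f1 t - f2 t) @[t --> x^'-] --> lim (f1 t @[t --> x^'-]) - lim (f2 t @[t --> x^'-]).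
    by apply: cvgB; exact: is_cvg_mono_left.
  apply: cvg_trans.
  apply: near_eq_cvg; apply: filterS (near_nbhs_left _ _ cx) => t /andP[? ?].
  by rewrite fE//; lra.
- exists (lim (f1 t @[t --> x^'+]) - lim (f2 t @[t --> x^'+])).
  have : (f1 t - f2 t) @[t --> x^'+] --> lim (f1 t @[t --> x^'+]) - lim (f2 t @[t --> x^'+]).
    by apply: cvgB; exact: nondecreasing_is_cvg_right.
  apply: cvg_trans.
  apply: near_eq_cvg; apply: filterS (near_nbhs_right _ _ xd) => t /andP[? ?].
  by rewrite fE//; lra.
Qed.

Lemma bv_loc_measurable a b f c d : bv_loc a b f -> oitv a b c -> oitv a b d ->
  c <= d -> measurable_fun (`[c, d] : set (measurableTypeR R)) f.
Proof.
move=> bvf cab dab cd.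
have [f1 [f2 [nd1 nd2 fE]]] := bv_loc_split _ _ _ _ _ bvf cab dab cd.
apply: (@eq_measurable_fun _ _ _ _ _ (f1 \- f2)).
  by move=> x; rewrite inE/= in_itv/= => /fE ->.
by apply: measurable_funB; apply: nondecreasing_measurable => //.
Qed.

Lemma nondecreasing_bv_loc a b f :
  (forall x y, oitv a b x -> oitv a b y -> x < y -> f x <= f y) -> bv_loc a b f.
Proof.
move=> nd c d cab dab cd; apply: nondecreasing_bounded_variation.
move=> x y; rewrite !in_itv/= => cxd cyd; rewrite le_eqVlt => /predU1P[->//|].
by apply: nd; [exact: (oitv_cc _ _ _ _ _ cab dab)|exact: (oitv_cc _ _ _ _ _ cab dab)].
Qed.

End one_sided_limits.

(** * Measures generated by functions of bounded variation *)

Section stieltjes_measure.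
Context {R : realType}.
Local Notation T := (measurableTypeR R).
Implicit Types (a b : \bar R) (nu : {charge set T -> \bar R}) (f g h : R -> R).
Implicit Types (c d x y z : R) (A : set T).

(** A ray meets [[c, d[] in the empty set or in [[max x c, d[], whose mass is a difference of two
    equal left limits. *)
Lemma generates_eq0 f c d nu A : generates f c d nu -> c <= d ->
  (forall x, c <= x <= d -> left_lim f x = left_lim f d) ->
  measurable A -> nu A = 0%E.
Proof.
move=> [nuI nuD] cd fcst; apply: charge_eq0 => x.
rewrite nuD; last exact: measurable_itv.
have [dx|xd] := leP d x.
  rewrite (_ : _ `&` _ = set0) ?charge0//.
  by apply/seteqP; split => z //=; rewrite !in_itv/= andbT => -[? /andP[? ?]]; lra.
rewrite (_ : _ `&` _ = `[Num.max x c, d[%classic); last first.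
  apply/seteqP; split => z /=; rewrite !in_itv/= andbT ge_max.
    by move=> [-> /andP[-> ->]].
  by move=> /andP[/andP[-> ->] ->].
have mcd : c <= Num.max x c <= d by rewrite le_max lexx orbT ge_max cd (ltW xd).
have /andP[m1 m2] := mcd.
by rewrite nuI// fcst// subrr.
Qed.

(** The charge is a restriction of a Lebesgue-Stieltjes measure; [generates_nondecreasing] states
    its existence without the sign, so the construction is repeated to keep it. *)
Lemma generates_nondecreasing_ge0 h c d : (forall x y, x <= y -> h x <= h y) ->
  c <= d -> exists nu, generates h c d nu /\
    forall A, measurable A -> (0 <= nu A)%E.
Proof.
move=> hnd cd.
have [mu muE] : exists mu : {measure set T -> \bar R}, forall x y, x <= y ->
    mu `[x, y[%classic = (left_lim h y - left_lim h x)%:E.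
  have lE z : left_lim h z = mono_left h z.
    by apply/cvg_lim => //; exact: mono_cvg_left.
  have H := @mono_mu_co _ _ hnd.
  by eexists => x y xy; rewrite !lE; exact: H.
have mD : measurable (`[c, d[%classic : set T) by exact: measurable_itv.
have Doo : (mu `[c, d[%classic < +oo)%E by rewrite muE// ltry.
exists (charge_of_finite_measure (mfrestr mD Doo)); split; [split|].
- move=> x y cx xy yd.
  rewrite /charge_of_finite_measure /= /mfrestr /= /mrestr.
  rewrite setIidl ?muE// => z /=; rewrite !in_itv/= => /andP[xz zy].
  by rewrite (le_trans cx xz) (lt_le_trans zy yd).
- move=> A mA; rewrite /charge_of_finite_measure /= /mfrestr /= /mrestr.
  by rewrite -setIA setIid.
- by move=> A mA; rewrite /charge_of_finite_measure /= measure_ge0.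
Qed.

Lemma stieltjes_ge0 a b f c d A :
  (forall x y, oitv a b x -> oitv a b y -> x < y -> f x <= f y) ->
  oitv a b c -> oitv a b d -> c < d -> measurable A ->
  (0 <= stieltjes f c d A)%E.
Proof.
move=> nd cab dab cd mA.
have bvf := nondecreasing_bv_loc _ _ _ nd.
(* Clamping starts left of [c], so that the left limit at [c] is not altered. *)
have [c' c'c c'ab] := oitv_left _ _ _ cab.
have c'd := lt_trans c'c cd.
pose p x := Num.max c' (Num.min x d).
have p1 x : c' <= p x <= d.
  by rewrite /p le_max lexx/= ge_max ge_min lexx orbT andbT; exact: ltW.
have p3 x y : x <= y -> p x <= p y.
  by move=> xy; rewrite /p le_max2 // le_min2.
have p4 x : c' <= x <= d -> p x = x.
  by move=> /andP[cx xd]; rewrite /p min_l// max_r.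
have hnd x y : x <= y -> (f \o p) x <= (f \o p) y.
  move=> /p3/=; rewrite le_eqVlt => /predU1P[->//|].
  by apply: nd; exact: (oitv_cc _ _ _ _ _ c'ab dab).
have [nu [gnu nu0]] := generates_nondecreasing_ge0 _ _ _ hnd (ltW cd).
have gf := stieltjesP bvf cab dab cd.
(* [stieltjes f c d] comes from a choice; it agrees with the positive charge [nu] because their
   difference is generated by the zero function. *)
suff : cadd (stieltjes f c d) (copp nu) A = 0%E.
  rewrite /cadd/= /copp/= => /eqP; rewrite sube_eq ?fin_num_measure//.
  by rewrite add0e => /eqP ->; exact: nu0.
have lE x : c <= x <= d -> left_lim (f \o p) x = left_lim f x.
  move=> /andP[cx xd]; apply/cvg_lim => //.
  have xab : oitv a b x by apply: (oitv_cc _ _ _ _ _ cab dab); rewrite cx.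
  apply: cvg_trans (cvg_left_lim _ _ _ (bv_loc_regulated _ _ _ bvf) _ xab).
  apply: near_eq_cvg; apply: filterS (near_nbhs_left _ _ (lt_le_trans c'c cx)).
  by move=> t /andP[? ?] /=; rewrite p4//; apply/andP; split; lra.
have l0 x : left_lim (fun _ : R => 0 : R) x = 0 by apply/cvg_lim => //; exact: cvg_cst.
apply: (generates_eq0 (fun=> 0) c d) => //; [|exact: ltW|by move=> x _; rewrite !l0].
split=> [x y cx xy yd|B mB].
  transitivity (stieltjes f c d `[x, y[%classic - nu `[x, y[%classic)%E => //.
  rewrite gf.1// gnu.1// -EFinB !lE ?l0; [|lra..].
  by rewrite !subrr.
transitivity (stieltjes f c d B - nu B)%E => //.
by rewrite [in LHS]gf.2// [in LHS]gnu.2.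
Qed.

Section bv.
Variables (a b : \bar R) (f : R -> R) (c d : R).
Hypotheses (bvf : bv_loc a b f) (cab : oitv a b c) (dab : oitv a b d).

Lemma stieltjes_co x y : c < d -> c <= x -> x <= y -> y <= d ->
  fine (stieltjes f c d `[x, y[%classic) = left_lim f y - left_lim f x.
Proof.
by move=> cd cx xy yd; rewrite (stieltjesP bvf cab dab cd).1.
Qed.

Lemma bigcup_itvco x y : (`]x, y[%classic : set T) =
  \bigcup_n `[x + n.+1%:R^-1, y[%classic.
Proof.
apply/seteqP; split => z /=.
  rewrite in_itv/= => /andP[xz zy].
  exists (Num.truncn (z - x)^-1) => //=; rewrite in_itv/= zy andbT -lerBrDl.
  rewrite invf_ple ?posrE ?subr_gt0//.
  by rewrite ltW// truncnS_gt.
move=> [n _]/=; rewrite !in_itv/= => /andP[xz ->]; rewrite andbT.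
by apply: lt_le_trans xz; rewrite ltrDl invr_gt0.
Qed.

Lemma nondecreasing_itvco x y :
  nondecreasing_seq (fun n => (`[x + n.+1%:R^-1, y[%classic : set T)).
Proof.
move=> m n mn; apply/subsetPset => z /=; rewrite !in_itv/= => /andP[xz ->].
rewrite andbT; apply: le_trans xz; rewrite lerD2l.
by rewrite lef_pV2 ?posrE// ler_nat.
Qed.

(** The singleton is [[x, d[] minus []x, d[], and the open interval is the increasing union of the
    [[x + 1 / (n + 1), d[], whose masses tend to [left_lim f d - right_lim f x]. *)
Lemma stieltjes_set1 x : c < d -> c <= x -> x < d ->
  fine (stieltjes f c d [set x]) = jump f x.
Proof.
move=> cd cx xd; set nu := stieltjes f c d.
have xab : oitv a b x by apply: (oitv_cc _ _ _ _ _ cab dab); rewrite cx ltW.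
have : fine (nu `]x, d[%classic) = left_lim f d - right_lim f x.
  have := charge_nondecreasing_cvg nu (fun n => `[x + n.+1%:R^-1, d[%classic).
  rewrite -bigcup_itvco => /(_ (fun=> measurable_itv _) (nondecreasing_itvco x d)).
  move/cvg_unique; apply => //.
  have : left_lim f d - left_lim f (x + n.+1%:R^-1) @[n --> \oo] -->
         left_lim f d - right_lim f x.
    apply: cvgB; first exact: cvg_cst.
    have := left_lim_cvg_right _ _ _ (bv_loc_regulated _ _ _ bvf) _ xab.
    move/cvg_at_rightP; apply; split.
      by move=> n; rewrite ltrDl invr_gt0.
    rewrite -[X in _ --> X]addr0; apply: cvgD; first exact: cvg_cst.
    exact: cvg_harmonic.
  apply: cvg_trans; apply: near_eq_cvg.
  have : \forall n \near \oo, n.+1%:R^-1 < d - x.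
    have /cvgr_lt := @cvg_harmonic R; apply; lra.
  apply: filterS => n; have : 0 < n.+1%:R^-1 :> R by rewrite invr_gt0.
  by move: (_^-1) => e e0 ed; rewrite stieltjes_co//; lra.
have := stieltjes_co x d cd cx (ltW xd) (lexx d).
rewrite -/nu (_ : `[x, d[%classic = [set x] `|` `]x, d[%classic); last first.
  by rewrite setU1itv// bnd_simp.
rewrite chargeU; [|exact: measurable_set1|exact: measurable_itv|]; last first.
  by apply/seteqP; split => z //= -[->]; rewrite in_itv/= ltxx.
rewrite fineD; [|exact: fin_num_measure..].
rewrite /jump; lra.
Qed.

End bv.

End stieltjes_measure.

(** * Pointwise form of the differential equation *)

Section solutions.
Context {R : realType}.
Local Notation T := (measurableTypeR R).
Implicit Types (a b : \bar R) (alpha beta gamma u v p q : R -> R) (x y z : R).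

(* What is kept of the measure-theoretic equation [du = p dalpha],
   [dp = u dbeta]: the jumps, and for each coefficient a comparison of the
   increments with those of a monotone function. *)
Record solution a b alpha beta u p : Prop := Solution {
  sol_reg : regulated a b u;
  sol_dreg : regulated a b p;
  sol_bal : forall x, oitv a b x -> u x = (left_lim u x + right_lim u x) / 2;
  sol_dbal : forall x, oitv a b x -> p x = (left_lim p x + right_lim p x) / 2;
  sol_jump : forall x, oitv a b x ->
    right_lim u x - left_lim u x = p x * jump alpha x;
  sol_djump : forall x, oitv a b x ->
    right_lim p x - left_lim p x = u x * jump beta x;
  sol_incr : forall x y (k M : R), oitv a b x -> oitv a b y -> x < y ->
    (forall z, x <= z < y -> `|p z - k| <= M) ->
    `|left_lim u y - left_lim u x - k * (left_lim alpha y - left_lim alpha x)|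
      <= M * (left_lim alpha y - left_lim alpha x);
  sol_dincr : forall c d, oitv a b c -> oitv a b d -> c < d -> exists V : R -> R,
    (forall x y, c <= x -> x <= y -> y <= d ->
      `|left_lim beta y - left_lim beta x| <= V y - V x) /\
    (forall x y (k M : R), c <= x -> x < y -> y <= d ->
      (forall z, x <= z < y -> `|u z - k| <= M) ->
      `|left_lim p y - left_lim p x - k * (left_lim beta y - left_lim beta x)|
        <= M * (V y - V x))
}.

Lemma Re_half (w z : R[i]) : w = z / 2%:R -> complex.Re w = complex.Re z / 2.
Proof.
move=> ->; case: z => x y.
have -> : (2%:R : R[i]) = (2%:R)%:C%C by rewrite rmorph_nat.
rewrite -[_ / _]/(_ * _^-1) -fmorphV/= mulr0 subr0.
by [].
Qed.

Lemma balanced_Re a b g x : balanced a b g -> oitv a b x ->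
  re_fun g x = (left_lim (re_fun g) x + right_lim (re_fun g) x) / 2.
Proof. by move=> [_ gE] /gE /Re_half. Qed.

Lemma real_balanced_solutionP a b alpha beta u :
  (forall x y, oitv a b x -> oitv a b y -> x < y -> alpha x < alpha y) ->
  bv_loc a b beta -> real_balanced_solution a b alpha beta u ->
  exists p, solution a b alpha beta u p.
Proof.
move=> alpha_incr bv_beta [bal_u _ [g [bal_g RN eqn]]].
have alpha_nd x y : oitv a b x -> oitv a b y -> x < y -> alpha x <= alpha y.
  by move=> xab yab xy; apply/ltW/alpha_incr.
have bv_alpha := nondecreasing_bv_loc _ _ _ alpha_nd.
(* The derivative may be complex, but [u], [alpha] and [beta] are real, so the real parts of both
   equations involve only the real part of [g]. *)
pose p := re_fun g; exists p.
have bv_u : bv_loc a b u := bal_u.1.1.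
have bv_p : bv_loc a b p := bal_g.1.1.
have uE c d A : in_window a b c d A ->
    fine (stieltjes u c d A) = charge_integral (stieltjes alpha c d) A p.
  by move=> /RN/(congr1 (@complex.Re R)).
have pE c d A : in_window a b c d A ->
    fine (stieltjes p c d A) = charge_integral (stieltjes beta c d) A u.
  move=> /eqn/(congr1 (@complex.Re R)) /=.
  by move=> /eqP; rewrite addrC subr_eq0 => /eqP ->.
split.
- exact: bv_loc_regulated.
- exact: bv_loc_regulated.
- by move=> x xab; have := balanced_Re _ _ _ _ bal_u xab.
- by move=> x xab; have := balanced_Re _ _ _ _ bal_g xab.
- move=> x xab; have [d xd dab] := oitv_right _ _ _ xab.
  have W : in_window a b x d [set x].
    by split=> // _ /= ->; rewrite in_itv/= lexx.
  have := uE _ _ _ W; rewrite charge_integral_set1.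
  by rewrite !(stieltjes_set1 a b).
- move=> x xab; have [d xd dab] := oitv_right _ _ _ xab.
  have W : in_window a b x d [set x].
    by split=> // _ /= ->; rewrite in_itv/= lexx.
  have := pE _ _ _ W; rewrite charge_integral_set1.
  by rewrite !(stieltjes_set1 a b).
- move=> x y k M xab yab xy pk.
  have W : in_window a b x y `[x, y[ by split => //; exact: measurable_itv.
  have mp : measurable_fun (`[x, y[ : set T) p.
    apply: measurable_funS (bv_loc_measurable _ _ _ _ _ bv_p xab yab (ltW xy)) => //.
    exact: subset_itv_co_cc.
  have := charge_integral_near_cst (stieltjes alpha x y) `[x, y[ p k M (measurable_itv _) mp pk.
  rewrite charge_ge0_chargeV; [|exact: measurable_itv|]; last first.
    by move=> B mB; exact: (stieltjes_ge0 a b).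
  by rewrite -uE// !(stieltjes_co a b)//; exact: ltW.
- move=> c d cab dab cd.
  pose nu := stieltjes beta c d.
  (* The variation of [d beta] on [[c, x[]: as [d beta] has no sign, errors cannot be measured by
     increments of [beta]. *)
  exists (fun x => chargeV nu `[c, x[); split.
    move=> x y cx xy yd.
    rewrite chargeV_itv// -(stieltjes_co a b beta c d)//.
    by apply: le_norm_chargeV; exact: measurable_itv.
  move=> x y k M cx xy yd uk.
  rewrite chargeV_itv ?(ltW xy)//.
  have xab : oitv a b x by apply: (oitv_cc _ _ _ _ _ cab dab); lra.
  have yab : oitv a b y by apply: (oitv_cc _ _ _ _ _ cab dab); lra.
  have mu : measurable_fun (`[x, y[ : set T) u.
    apply: measurable_funS (bv_loc_measurable _ _ _ _ _ bv_u xab yab (ltW xy)) => //.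
    exact: subset_itv_co_cc.
  have W : in_window a b c d `[x, y[.
    split => // z /=; rewrite !in_itv/= => /andP[? ?].
    by apply/andP; split; lra.
  have := charge_integral_near_cst nu `[x, y[ u k M (measurable_itv _) mu uk.
  rewrite -pE// !(stieltjes_co a b)//; exact: ltW.
Qed.

End solutions.

Arguments sol_reg {R a b alpha beta u p}.
Arguments sol_dreg {R a b alpha beta u p}.
Arguments sol_bal {R a b alpha beta u p}.
Arguments sol_dbal {R a b alpha beta u p}.
Arguments sol_jump {R a b alpha beta u p}.
Arguments sol_djump {R a b alpha beta u p}.
Arguments sol_incr {R a b alpha beta u p}.
Arguments sol_dincr {R a b alpha beta u p}.

Section constant_generator.
Context {R : realType}.
Local Notation T := (measurableTypeR R).

Lemma stieltjes_eq0 (a b : \bar R) (f : R -> R) (s t c d : R) (A : set T) :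
  bv_loc a b f -> in_window a b c d A -> A `<=` `]s, t[ ->
  (forall x y, s < x -> x <= y -> y < t -> left_lim f x = left_lim f y) ->
  stieltjes f c d A = 0%E.
Proof.
move=> bvf [cab dab cd mA Acd] Ast fcst.
have [nuI nuD] := stieltjesP bvf cab dab cd.
set nu := stieltjes f c d in nuI nuD *.
pose e n : R := n.+1%:R^-1.
have e0 n : 0 < e n by rewrite invr_gt0.
(* [left_lim f] is known to be constant strictly between [s] and [t] only, so [A] is exhausted by
   its traces on windows that stay away from both ends. *)
pose D n : set T := `[Num.max c (s + e n), Num.min d (t - e n)[%classic.
have mD n : measurable (D n) by exact: measurable_itv.
have -> : A = \bigcup_n (A `&` D n).
  apply/seteqP; split => z; last by move=> [n _ []].
  move=> Az; have := Acd _ Az; have := Ast _ Az.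
  rewrite /= !in_itv/= => /andP[sz zt] /andP[cz zd].
  have : \forall n \near \oo, e n < Num.min (z - s) (t - z).
    have /cvgr_lt := @cvg_harmonic R; apply.
    by rewrite lt_min !subr_gt0 sz.
  move=> [n _ /(_ n (leqnn n))] /=; rewrite lt_min => /andP[? ?].
  exists n => //; split => //=.
  rewrite /D/= in_itv/= ge_max lt_min cz zd /=; apply/andP; split; lra.
apply: charge_bigcup_eq0 => [n|m n mn|n].
- exact: measurableI.
- apply/subsetPset => z [Az Dz]; split => //.
  have enm : e n <= e m by rewrite lef_pV2 ?posrE// ler_nat.
  move: Dz; rewrite /D/= !in_itv/= !ge_max !lt_min.
  by move=> /andP[/andP[-> ?] /andP[-> ?]]/=; apply/andP; split; lra.
- have [yx|xy] := ltP (Num.min d (t - e n)) (Num.max c (s + e n)).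
    rewrite (_ : A `&` _ = set0) ?charge0//.
    apply/seteqP; split => z //= -[_]; rewrite /D/= in_itv/= => /andP[? ?]; lra.
  have := xy; rewrite le_min !ge_max => /andP[/andP[_ ?] /andP[? ?]].
  have := e0 n => en0.
  (* The restriction of [nu] to [D n] is again generated by [f], on a window where [left_lim f] is
     constant. *)
  suff : crestr0 nu (mD n) A = 0%E by rewrite /crestr0 mem_set.
  have m1 : s < Num.max c (s + e n) by rewrite lt_max ltrDl en0 orbT.
  have m2 : Num.min d (t - e n) < t by rewrite gt_min gtrBl en0 orbT.
  have m3 : c <= Num.max c (s + e n) by rewrite le_max lexx.
  have m4 : Num.min d (t - e n) <= d by rewrite ge_min lexx.
  apply: (generates_eq0 f (Num.max c (s + e n)) (Num.min d (t - e n))) => //.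
    split=> [x y cx xxy yd|B mB].
      rewrite /= /crestr0 mem_set; last exact: measurable_itv.
      rewrite /crestr (_ : _ `&` _ = `[x, y[%classic).
        by rewrite nuI//; [exact: le_trans m3 cx|exact: le_trans yd m4].
      apply/seteqP; split => z /=; rewrite !in_itv/=; first by case.
      move=> /andP[xz zy]; rewrite /D/= in_itv/= xz zy.
      by rewrite (le_trans cx xz) (lt_le_trans zy yd).
    rewrite /= /crestr0 !mem_set//; last exact: measurableI.
    by rewrite /crestr -/(D n) -setIA setIid.
  by move=> x /andP[? ?]; apply: fcst => //; apply: lt_le_trans m1 _.
Qed.

End constant_generator.

(** * Real induction and the Wronskian *)

Section real_induction.
Context {R : realType}.
Implicit Types (P : R -> Prop) (x y z : R).

(** Let [m] be the supremum of the [y] such that [P] holds on [[x0, y]]. The closure condition gives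
    [P m], and the step to the right then forbids [m < x1]. *)
Lemma real_induction P x0 x1 : x0 <= x1 -> P x0 ->
  (forall y, x0 <= y -> y < x1 -> P y -> \forall z \near y^'+, P z) ->
  (forall y, x0 < y -> y <= x1 -> (forall z, x0 <= z -> z < y -> P z) -> P y) ->
  P x1.
Proof.
move=> x01 P0 Pr Pl.
pose S := [set y | x0 <= y <= x1 /\ forall z, x0 <= z <= y -> P z].
have S0 : S x0 by split; [rewrite lexx|move=> z zx; have -> : z = x0 by lra].
have hS : has_sup S by split; [exists x0|exists x1 => y [/andP[]]].
pose m := sup S.
have m0 : x0 <= m by exact: ub_le_sup hS.2 _ S0.
have m1 : m <= x1 by apply: ge_sup; [exists x0|move=> y [/andP[]]].
have Pm' z : x0 <= z -> z < m -> P z.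
  move=> xz zm; have [y Sy zy] := sup_gt hS.1 zm.
  by apply: Sy.2; rewrite xz ltW.
have Pm : P m.
  move: m0; rewrite le_eqVlt => /predU1P[<-//|m0]; exact: Pl.
move: m1; rewrite le_eqVlt => /predU1P[<-//|m1].
have /near_rightP[e e0 he] := Pr m m0 m1 Pm.
suff Sy : S (Num.min (m + e / 2) x1).
  have := ub_le_sup hS.2 Sy; rewrite -/m ge_min; lra.
have ym : m <= Num.min (m + e / 2) x1 by rewrite le_min; apply/andP; split; lra.
split.
  by rewrite (le_trans m0 ym) ge_min lexx orbT.
move=> z /andP[xz]; rewrite le_min => /andP[ze zx1].
have [zm|mz|->//] := ltgtP z m; first exact: Pm'.
by apply: he; lra.
Qed.

Lemma real_induction_left P x0 x1 : x0 <= x1 -> P x1 ->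
  (forall y, x0 < y -> y <= x1 -> P y -> \forall z \near y^'-, P z) ->
  (forall y, x0 <= y -> y < x1 -> (forall z, y < z -> z <= x1 -> P z) -> P y) ->
  P x0.
Proof.
move=> x01 P1 Pl Pr; rewrite -[x0]opprK.
apply: (@real_induction (fun z => P (- z)) (- x1) (- x0)).
- by rewrite lerN2.
- by rewrite opprK.
- move=> y y1 y0 Py.
  have /near_leftP[e e0 he] : \forall z \near (- y)^'-, P z by apply: Pl => //; lra.
  by apply/near_rightP; exists e => // z zy; apply: he; lra.
- move=> y y1 y0 Py; apply: Pr; [lra..|] => z yz z1.
  by rewrite -[z]opprK; apply: Py; lra.
Qed.

(** The errors telescope along [V]: real induction yields [F x1 <= F x0 + e * (V x1 - V x0)] for
    every [e > 0]. *)
Lemma nonincreasing_of_near (F V : R -> R) x0 x1 : x0 <= x1 ->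
  (forall y, x0 < y -> y <= x1 -> F z @[z --> y^'-] --> F y) ->
  (forall y z, x0 <= y -> y <= z -> z <= x1 -> V y <= V z) ->
  (forall e : R, 0 < e -> forall y, x0 <= y -> y < x1 ->
    \forall z \near y^'+, F z <= F y + e * (V z - V y)) ->
  F x1 <= F x0.
Proof.
move=> x01 Fl Vnd FV.
suff H (e : R) : 0 < e -> F x1 <= F x0 + e * (V x1 - V x0).
  rewrite leNgt; apply/negP => F01.
  have V01 := Vnd _ _ (lexx _) x01 (lexx _).
  (* The summand 1 keeps [k] positive when [V] is constant. With [e = (F x1 - F x0) / k] the bound
     becomes [F x1 - F x0 <= (F x1 - F x0) * (1 - k^-1)], which is absurd. *)
  pose k := 1 + (V x1 - V x0).
  have k0 : 0 < k by rewrite /k; lra.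
  have := H ((F x1 - F x0) / k); rewrite divr_gt0 ?subr_gt0// => /(_ isT).
  rewrite mulrAC -mulrA (_ : (V x1 - V x0) / k = 1 - k^-1); last first.
    by rewrite /k; field; rewrite -/k gt_eqF.
  have : 0 < k^-1 by rewrite invr_gt0.
  by move: (_^-1) => l l0; nra.
move=> e0; apply: (@real_induction (fun z => F z <= F x0 + e * (V z - V x0)) x0 x1) => //.
- by rewrite subrr mulr0 addr0.
- move=> y x0y yx1 Fy; apply: filterS (FV e e0 y x0y yx1) => z Fz; lra.
(* Only [F] has to be left-continuous: for [V] the inequality [V z <= V y] suffices. *)
- move=> y x0y yx1 Fy; apply: cvgr_to_le (Fl y x0y yx1) _.
  apply: filterS (near_nbhs_left _ _ x0y) => z /andP[xz zy].
  apply: le_trans (Fy z (ltW xz) zy) _.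
  rewrite lerD2l ler_pM2l// lerD2r; apply: Vnd => //; exact: ltW.
Qed.

End real_induction.

Section increasing_limits.
Context {R : realType}.
Variables (a b : \bar R) (alpha : R -> R).
Hypothesis alpha_incr :
  forall x y, oitv a b x -> oitv a b y -> x < y -> alpha x < alpha y.
Implicit Types x y z : R.

Lemma increasing_regulated : regulated a b alpha.
Proof.
apply: bv_loc_regulated; apply: nondecreasing_bv_loc => x y xab yab xy.
exact/ltW/alpha_incr.
Qed.

Lemma le_right_lim_increasing x z : oitv a b x -> oitv a b z -> x < z ->
  right_lim alpha x <= alpha z.
Proof.
move=> xab zab xz; apply: (cvgr_to_le (cvg_right_lim _ _ _ increasing_regulated _ xab)).
apply: filterS (near_nbhs_right _ _ xz) => t /andP[xt tz].
apply/ltW/alpha_incr => //; apply: (oitv_cc _ _ _ _ _ xab zab); lra.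
Qed.

Lemma ge_left_lim_increasing z y : oitv a b z -> oitv a b y -> z < y ->
  alpha z <= left_lim alpha y.
Proof.
move=> zab yab zy; apply: (cvgr_to_ge (cvg_left_lim _ _ _ increasing_regulated _ yab)).
apply: filterS (near_nbhs_left _ _ zy) => t /andP[zt ty].
apply/ltW/alpha_incr => //; apply: (oitv_cc _ _ _ _ _ zab yab); lra.
Qed.

Lemma right_lim_lt_left_lim x y : oitv a b x -> oitv a b y -> x < y ->
  right_lim alpha x < left_lim alpha y.
Proof.
move=> xab yab xy.
have sub z : x <= z <= y -> oitv a b z by exact: (oitv_cc _ _ _ _ _ xab yab).
(* Limits keep only weak inequalities; strictness comes from [alpha z < alpha w] at two interior
   points. *)
pose z := (2 * x + y) / 3; pose w := (x + 2 * y) / 3.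
have zab : oitv a b z by apply: sub; rewrite /z; lra.
have wab : oitv a b w by apply: sub; rewrite /w; lra.
apply: (@le_lt_trans _ _ (alpha z)).
  by apply: le_right_lim_increasing => //; rewrite /z; lra.
apply: (@lt_le_trans _ _ (alpha w)).
  by apply: alpha_incr => //; rewrite /z /w; lra.
by apply: ge_left_lim_increasing => //; rewrite /w; lra.
Qed.

Lemma jump_increasing_ge0 x : oitv a b x -> 0 <= jump alpha x.
Proof.
move=> xab; rewrite subr_ge0; apply: (@le_trans _ _ (alpha x)).
  apply: (cvgr_to_le (cvg_left_lim _ _ _ increasing_regulated _ xab)).
  have [c cx cab] := oitv_left _ _ _ xab.
  apply: filterS (near_nbhs_left _ _ cx) => t /andP[ct tx].
  apply/ltW/alpha_incr => //; apply: (oitv_cc _ _ _ _ _ cab xab); lra.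
apply: (cvgr_to_ge (cvg_right_lim _ _ _ increasing_regulated _ xab)).
have [d xd dab] := oitv_right _ _ _ xab.
apply: filterS (near_nbhs_right _ _ xd) => t /andP[xt td].
apply/ltW/alpha_incr => //; apply: (oitv_cc _ _ _ _ _ xab dab); lra.
Qed.

Lemma left_lim_increasing x y : oitv a b x -> oitv a b y -> x < y ->
  left_lim alpha x < left_lim alpha y.
Proof.
move=> xab yab xy; apply: le_lt_trans (right_lim_lt_left_lim _ _ xab yab xy).
by rewrite -subr_ge0 jump_increasing_ge0.
Qed.

End increasing_limits.

(** * The Wronskian of two solutions *)

Section wronskian.
Context {R : realType}.
Variables (a b : \bar R) (alpha beta1 beta2 u v p q : R -> R).
Hypothesis alpha_incr :
  forall x y, oitv a b x -> oitv a b y -> x < y -> alpha x < alpha y.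
Hypotheses (beta1_bv : bv_loc a b beta1) (beta2_bv : bv_loc a b beta2).
Hypotheses (u_sol : solution a b alpha beta1 u p)
  (v_sol : solution a b alpha beta2 v q).
Implicit Types x y z : R.

(** The Wronskian is used through its one-sided limits, not through the values of [u], [v], [p],
    [q]: at a jump, a product of means is not the mean of the products. *)
Definition wronskian_left x :=
  left_lim u x * left_lim q x - left_lim v x * left_lim p x.

Definition wronskian_right x :=
  right_lim u x * right_lim q x - right_lim v x * right_lim p x.

(** When values are means of one-sided limits, [f g] jumps by exactly [f * jump g + g * jump f]; the
    two terms [p q * jump alpha] cancel. *)
Lemma wronskian_jump x : oitv a b x -> wronskian_right x - wronskian_left x =
  - (u x * v x * (jump beta1 x - jump beta2 x)).
Proof.
move=> xab; rewrite /wronskian_left /wronskian_right.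
have /eqP := sol_jump u_sol x xab; rewrite subr_eq => /eqP ur.
have /eqP := sol_jump v_sol x xab; rewrite subr_eq => /eqP vr.
have /eqP := sol_djump u_sol x xab; rewrite subr_eq => /eqP pr.
have /eqP := sol_djump v_sol x xab; rewrite subr_eq => /eqP qr.
have := sol_bal u_sol x xab; have := sol_bal v_sol x xab.
have := sol_dbal u_sol x xab; have := sol_dbal v_sol x xab.
rewrite ur vr pr qr.
set ul := left_lim u x; set vl := left_lim v x.
set pl := left_lim p x; set ql := left_lim q x.
move: (jump alpha x) (jump beta1 x) (jump beta2 x) (u x) (v x) (p x) (q x).
move=> A B1 B2 u0 v0 p0 q0 qE pE vE uE.
have -> : ql = q0 - v0 * B2 / 2 by lra.
have -> : pl = p0 - u0 * B1 / 2 by lra.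
have -> : ul = u0 - p0 * A / 2 by lra.
have -> : vl = v0 - q0 * A / 2 by lra.
by field.
Qed.

Lemma wronskian_cvg_left x : oitv a b x ->
  wronskian_left y @[y --> x^'-] --> wronskian_left x.
Proof.
move=> xab; apply: cvgB; apply: cvgM; apply: left_lim_cvg_left xab.
- exact: sol_reg u_sol.
- exact: sol_dreg v_sol.
- exact: sol_reg v_sol.
- exact: sol_dreg u_sol.
Qed.

Lemma wronskian_cvg_right x : oitv a b x ->
  wronskian_left y @[y --> x^'+] --> wronskian_right x.
Proof.
move=> xab; apply: cvgB; apply: cvgM; apply: left_lim_cvg_right xab.
- exact: sol_reg u_sol.
- exact: sol_dreg v_sol.
- exact: sol_reg v_sol.
- exact: sol_dreg u_sol.
Qed.

Let gamma x := left_lim beta1 x - left_lim beta2 x.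

Lemma le_of_increment (A B g r r' : R) :
  A - B + g <= r -> 0 <= g -> r <= r' -> A - r' <= B.
Proof. by lra. Qed.
Arguments le_of_increment {A B g r r'}.

Lemma le_of_bound (A B r r' : R) : r <= r' -> A - B <= r -> A - r' <= B.
Proof. by lra. Qed.
Arguments le_of_bound {A B r r'}.

Lemma normM_le (x y X Y : R) : `|x| <= X -> `|y| <= Y ->
  - (X * Y) <= x * y <= X * Y.
Proof. by move=> xX yY; rewrite -ler_norml normrM ler_pM. Qed.

(* The second order remainder in the product rule for [u q - v p]: the first
   order terms in [dalpha] cancel. *)
Lemma wronskian_estimate (e K u0 v0 p0 q0 u1 v1 p1 q1 u2 v2 p2 q2 A B1 B2 V1 V2 : R) :
  0 <= e -> e <= 1 -> 0 <= A ->
  `|u0| + 1 <= K -> `|v0| + 1 <= K -> `|p0| + 1 <= K -> `|q0| + 1 <= K ->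
  `|u2 - u0| <= e -> `|v2 - v0| <= e -> `|p1 - p0| <= e -> `|q1 - q0| <= e ->
  `|B1| <= V1 -> `|B2| <= V2 ->
  `|u2 - u1 - p0 * A| <= e * A -> `|v2 - v1 - q0 * A| <= e * A ->
  `|p2 - p1 - u0 * B1| <= e * V1 -> `|q2 - q1 - v0 * B2| <= e * V2 ->
  `|u2 * q2 - v2 * p2 - (u1 * q1 - v1 * p1) + u0 * v0 * (B1 - B2)|
    <= 4 * (e * K) * (A + V1 + V2).
Proof.
move=> e0 e1 A0 u0K v0K p0K q0K u2u v2v p1p q1q BV1 BV2 uA vA pB qB.
have K0 : 0 <= K by apply: le_trans u0K; rewrite addr_ge0.
have V10 : 0 <= V1 by apply: le_trans BV1.
have V20 : 0 <= V2 by apply: le_trans BV2.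
have bnd x y : `|x - y| <= e -> `|y| + 1 <= K -> `|x| <= K.
  move=> xy yK; rewrite -[x](subrK y) (le_trans (ler_normD _ _))//; lra.
have u2K := bnd _ _ u2u u0K; have v2K := bnd _ _ v2v v0K.
have p1K := bnd _ _ p1p p0K; have q1K := bnd _ _ q1q q0K.
have normM3 x y z : `|x| <= e -> `|y| + 1 <= K -> 0 <= z ->
    forall w, `|w| <= z -> - (e * K * z) <= x * y * w <= e * K * z.
  move=> xe yK z0 w wz; apply: normM_le => //.
  by rewrite normrM ler_pM//; lra.
have h1 := normM3 _ _ _ u2u v0K V20 _ BV2.
have h2 := normM_le _ _ _ _ u2K qB.
have AA : `|A| <= A by rewrite ger0_norm.
have h3 := normM3 _ _ _ q1q p0K A0 _ AA.
have h4 := normM_le _ _ _ _ q1K uA.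
have h5 := normM3 _ _ _ v2v u0K V10 _ BV1.
have h6 := normM_le _ _ _ _ v2K pB.
have h7 := normM3 _ _ _ p1p q0K A0 _ AA.
have h8 := normM_le _ _ _ _ p1K vA.
(* Discrete product rule [u2 q2 - u1 q1 = u2 (q2 - q1) + q1 (u2 - u1)], and the same for [v p]. Four
   of the eight terms are bounded by [e * K * A], whence the constant 4. *)
rewrite (_ : _ + u0 * v0 * (B1 - B2) =
  (u2 - u0) * v0 * B2 + u2 * (q2 - q1 - v0 * B2) + (q1 - q0) * p0 * A
  + q1 * (u2 - u1 - p0 * A) - (v2 - v0) * u0 * B1 - v2 * (p2 - p1 - u0 * B1)
  - (p1 - p0) * q0 * A - p1 * (v2 - v1 - q0 * A)); last by ring.
have eKA : 0 <= e * K * A by rewrite !mulr_ge0.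
have eK1 : 0 <= e * K * V1 by rewrite !mulr_ge0.
have eK2 : 0 <= e * K * V2 by rewrite !mulr_ge0.
have -> : 4 * (e * K) * (A + V1 + V2) =
  4 * (e * K * A) + 4 * (e * K * V1) + 4 * (e * K * V2) by ring.
move: h1 h2 h3 h4 h5 h6 h7 h8.
rewrite (_ : K * (e * V2) = e * K * V2) 1?(_ : K * (e * V1) = e * K * V1)
  1?(_ : K * (e * A) = e * K * A); [|ring..].
set t1 := _ * v0 * B2; set t2 := u2 * _; set t3 := _ * p0 * A.
set t4 := q1 * _; set t5 := _ * u0 * B1; set t6 := v2 * _.
set t7 := _ * q0 * A; set t8 := p1 * _.
clearbody t1 t2 t3 t4 t5 t6 t7 t8.
clear e0 e1 A0 u0K v0K p0K q0K u2u v2v p1p q1q BV1 BV2 uA vA pB qB K0 V10 V20.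
clear bnd u2K v2K p1K q1K normM3 AA.
move: (e * K * A) (e * K * V1) (e * K * V2) eKA eK1 eK2 => X Y Z X0 Y0 Z0.
move=> /andP[? ?] /andP[? ?] /andP[? ?] /andP[? ?] /andP[? ?] /andP[? ?].
move=> /andP[? ?] /andP[? ?].
by rewrite ler_norml; apply/andP; split; lra.
Qed.


(** Both [x] and [z] lie strictly to the right of [y], because a jump at [y] is not small. Later [x]
    tends to [y], and the jump itself is left to [wronskian_jump]. *)
Lemma wronskian_local (c d : R) : oitv a b c -> oitv a b d -> c < d ->
  exists V : R -> R,
    (forall x y, c <= x -> x <= y -> y <= d -> V x <= V y) /\
    forall y (e : R), c <= y -> y < d -> 0 < e ->
      \forall z \near y^'+, forall x, y < x -> x < z ->
        `|wronskian_left z - wronskian_left x +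
          right_lim u y * right_lim v y * (gamma z - gamma x)| <= e * (V z - V x).
Proof.
move=> cab dab cd.
have [V1 [V1B V1p]] := sol_dincr u_sol _ _ cab dab cd.
have [V2 [V2B V2q]] := sol_dincr v_sol _ _ cab dab cd.
exists (fun x => left_lim alpha x + V1 x + V2 x); split.
  move=> x y cx xy yd.
  have := V1B x y cx xy yd; have := V2B x y cx xy yd.
  have := normr_ge0 (left_lim beta1 y - left_lim beta1 x).
  have := normr_ge0 (left_lim beta2 y - left_lim beta2 x).
  suff : left_lim alpha x <= left_lim alpha y by lra.
  move: xy; rewrite le_eqVlt => /predU1P[->//|xy].
  by apply/ltW/(left_lim_increasing a b) => //; apply: (oitv_cc _ _ _ _ _ cab dab); lra.
move=> y e cy yd e0.
have yab : oitv a b y by apply: (oitv_cc _ _ _ _ _ cab dab); lra.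
pose K := 1 + `|right_lim u y| + `|right_lim v y| + `|right_lim p y| + `|right_lim q y|.
have [uK vK pK qK] : [/\ `|right_lim u y| + 1 <= K, `|right_lim v y| + 1 <= K,
    `|right_lim p y| + 1 <= K & `|right_lim q y| + 1 <= K].
  have nu := normr_ge0 (right_lim u y); have nv := normr_ge0 (right_lim v y).
  have np := normr_ge0 (right_lim p y); have nq := normr_ge0 (right_lim q y).
  by split; rewrite /K; lra.
have K1 : 1 <= K by rewrite /K -!addrA lerDl !addr_ge0.
(* [wronskian_estimate] asks for [h <= 1] and has error [4 * (h * K)], which has to stay below
   [e]. *)
pose h := Num.min 1 (e / (4 * K)).
have eK0 : 0 < e / (4 * K) by rewrite divr_gt0//; lra.
have h0 : 0 < h by rewrite lt_min ltr01 eK0.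
have h1 : h <= 1 by rewrite ge_min lexx.
have hK : 4 * (h * K) <= e.
  have : h <= e / (4 * K) by rewrite ge_min lexx orbT.
  by rewrite ler_pdivlMr; lra.
have /near_rightP[r r0 hr] := regulated_near_right _ _ _ (sol_reg u_sol) _ _ yab h0.
have /near_rightP[r' r'0 hr'] := regulated_near_right _ _ _ (sol_reg v_sol) _ _ yab h0.
have /near_rightP[r2 r20 hr2] := regulated_near_right _ _ _ (sol_dreg u_sol) _ _ yab h0.
have /near_rightP[r3 r30 hr3] := regulated_near_right _ _ _ (sol_dreg v_sol) _ _ yab h0.
apply/near_rightP; exists (Num.min (Num.min r r') (Num.min (Num.min r2 r3) (d - y))).
  by rewrite !lt_min r0 r'0 r20 r30 subr_gt0.
move=> z; rewrite -ltrBlDl !lt_min -!andbA => /and5P[yz zr zr' zr2 /andP[zr3]].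
rewrite ltrD2r => zd x yx xz; rewrite !ltrBlDl in zr zr' zr2 zr3.
have cx := le_trans cy (ltW yx); have zd' := ltW zd.
have xab : oitv a b x.
  by apply: (oitv_cc _ _ _ _ _ cab dab); rewrite cx (le_trans (ltW xz)).
have zab : oitv a b z.
  by apply: (oitv_cc _ _ _ _ _ cab dab); rewrite zd' (le_trans cx (ltW xz)).
have hu w : x <= w <= z -> [/\ `|u w - right_lim u y| <= h,
    `|left_lim u w - right_lim u y| <= h & `|right_lim u w - right_lim u y| <= h].
  by move=> /andP[xw wz]; apply: hr; rewrite (lt_le_trans yx xw) (le_lt_trans wz).
have hv w : x <= w <= z -> [/\ `|v w - right_lim v y| <= h,
    `|left_lim v w - right_lim v y| <= h & `|right_lim v w - right_lim v y| <= h].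
  by move=> /andP[xw wz]; apply: hr'; rewrite (lt_le_trans yx xw) (le_lt_trans wz).
have hp w : x <= w <= z -> [/\ `|p w - right_lim p y| <= h,
    `|left_lim p w - right_lim p y| <= h & `|right_lim p w - right_lim p y| <= h].
  by move=> /andP[xw wz]; apply: hr2; rewrite (lt_le_trans yx xw) (le_lt_trans wz).
have hq w : x <= w <= z -> [/\ `|q w - right_lim q y| <= h,
    `|left_lim q w - right_lim q y| <= h & `|right_lim q w - right_lim q y| <= h].
  by move=> /andP[xw wz]; apply: hr3; rewrite (lt_le_trans yx xw) (le_lt_trans wz).
have xx : x <= x <= z by rewrite lexx ltW.
have zz : x <= z <= z by rewrite lexx ltW.
have A0 := left_lim_increasing _ _ _ alpha_incr _ _ xab zab xz.
have lez w : x <= w < z -> x <= w <= z by move=> /andP[-> /ltW].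
have D0 : 0 <= left_lim alpha z - left_lim alpha x + (V1 z - V1 x) + (V2 z - V2 x).
  apply: addr_ge0; first apply: addr_ge0.
  - by rewrite subr_ge0 ltW.
  - exact: le_trans (normr_ge0 _) (V1B _ _ cx (ltW xz) zd').
  - exact: le_trans (normr_ge0 _) (V2B _ _ cx (ltW xz) zd').
have gE : gamma z - gamma x = (left_lim beta1 z - left_lim beta1 x) -
    (left_lim beta2 z - left_lim beta2 x).
  by rewrite /gamma !opprD addrACA.
rewrite [X in _ * X]gE /= (_ : left_lim alpha z + V1 z + V2 z - _ =
  left_lim alpha z - left_lim alpha x + (V1 z - V1 x) + (V2 z - V2 x)); last by ring.
apply: le_trans (ler_wpM2r D0 hK).
apply: (wronskian_estimate h K _ _ (right_lim p y) (right_lim q y)).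
- exact: ltW.
- by [].
- by rewrite subr_ge0 ltW.
- exact: uK.
- exact: vK.
- exact: pK.
- exact: qK.
- by have [] := hu z zz.
- by have [] := hv z zz.
- by have [] := hp x xx.
- by have [] := hq x xx.
- exact: V1B (ltW xz) _.
- exact: V2B (ltW xz) _.
- by apply: (sol_incr u_sol) => // w /lez/hp[].
- by apply: (sol_incr v_sol) => // w /lez/hq[].
- by apply: V1p => // w /lez/hu[].
- by apply: V2q => // w /lez/hv[].
Qed.

(** Atoms of [d(beta1 - beta2)] are handled by [wronskian_jump] and the rest by [wronskian_local];
    hence two sign conditions on [u v], one with the values and one with the right limits. *)
Lemma wronskian_le x y : oitv a b x -> oitv a b y -> x <= y ->
  (forall z, x <= z -> z < y -> 0 <= u z * v z * (jump beta1 z - jump beta2 z)) ->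
  (forall z, x <= z -> z < y -> 0 <= right_lim u z * right_lim v z) ->
  (forall z w, x < z -> z <= w -> w < y -> gamma z <= gamma w) ->
  wronskian_left y <= wronskian_left x.
Proof.
move=> xab yab; rewrite le_eqVlt => /predU1P[->//|xy] uvJ uvR gnd.
have [V [Vnd VW]] := wronskian_local _ _ xab yab xy.
have sub z : x <= z <= y -> oitv a b z by exact: (oitv_cc _ _ _ _ _ xab yab).
apply: (nonincreasing_of_near wronskian_left V _ _ (ltW xy)).
- by move=> z xz zy; apply: wronskian_cvg_left; apply: sub; lra.
- exact: Vnd.
- move=> e e0 z xz zy.
  have zab : oitv a b z by apply: sub; lra.
  have Wj := wronskian_jump _ zab; have uvJz := uvJ _ xz zy.
  have Wz : wronskian_right z <= wronskian_left z.
    by rewrite -subr_le0 Wj oppr_le0.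
  suff : \forall w \near z^'+, wronskian_left w - e * (V w - V z) <= wronskian_right z.
    by apply: filterS => w; rewrite lerBlDr => /le_trans; apply; rewrite lerD2r.
  apply: filterS (filterI (VW z e xz zy e0) (near_nbhs_right _ _ zy)) => w [wW /andP[zw wy]].
  (* The estimate between [x'] and [w] is used as [x'] decreases to [z], where [wronskian_left x']
     tends to [wronskian_right z]. *)
  apply: (cvgr_to_ge (wronskian_cvg_right _ zab)).
  apply: filterS (near_nbhs_right _ _ zw) => x' /andP[zx' x'w].
  have := wW x' zx' x'w; rewrite ler_norml => /andP[_].
  have g0 : 0 <= gamma w - gamma x' by rewrite subr_ge0; apply: gnd; lra.
  move=> WwWx; apply: (le_of_increment WwWx (mulr_ge0 (uvR _ xz zy) g0)).
  have : e * (V w - V x') <= e * (V w - V z).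
    by rewrite ler_pM2l// lerD2l lerN2; apply: Vnd => //; apply: ltW => //; exact: lt_trans wy.
  by [].
Qed.

(** The local estimate is read backwards: with [W = 0] it bounds [u v] times the increment of
    [gamma] by an arbitrarily small error, and [u v > 0] can be divided out. *)
Lemma wronskian_eq0_const (s t : R) : oitv a b s -> oitv a b t ->
  (forall x, s < x -> x < t -> wronskian_left x = 0) ->
  (forall x, s < x -> x < t -> 0 < u x * v x) ->
  (forall x, s < x -> x < t -> 0 < right_lim u x * right_lim v x) ->
  forall x y, s < x -> x <= y -> y < t -> gamma y <= gamma x.
Proof.
move=> sab tab W0 uv uvR x y sx; rewrite le_eqVlt => /predU1P[->//|xy] yt.
have sub z : s <= z <= t -> oitv a b z by exact: (oitv_cc _ _ _ _ _ sab tab).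
have xab : oitv a b x by apply: sub; lra.
have yab : oitv a b y by apply: sub; lra.
have [V [Vnd VW]] := wronskian_local _ _ xab yab xy.
apply: (nonincreasing_of_near gamma V _ _ (ltW xy)).
- move=> z xz zy; have zab : oitv a b z by apply: sub; lra.
  by apply: cvgB; apply: left_lim_cvg_left zab; exact: bv_loc_regulated.
- exact: Vnd.
- move=> e e0 z xz zy.
  have [sz zt] : s < z /\ z < t by split; lra.
  have zab : oitv a b z by apply: sub; lra.
  have m0 := uvR _ sz zt; set m := _ * _ in m0.
  (* [W] vanishes on both sides of [z] and [u z * v z > 0], so [d(beta1 - beta2)] has no atom at
     [z]. *)
  have gj : right_lim beta1 z - right_lim beta2 z = gamma z.
    have WR0 : wronskian_right z = 0.
      have := wronskian_cvg_right _ zab; move/cvg_unique; apply => //.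
      apply: cvg_near_cst; apply: filterS (near_nbhs_right _ _ zt) => w /andP[zw wt].
      by apply: W0; lra.
    have := wronskian_jump _ zab; rewrite WR0 W0// subrr => /esym/eqP.
    rewrite oppr_eq0 mulf_eq0 gt_eqF ?uv//= /jump /gamma => /eqP; lra.
  (* The local estimate is taken with error [e * m], so that dividing by [m] leaves [e]. *)
  have em0 : 0 < e * m by rewrite mulr_gt0.
  apply: filterS (filterI (VW z (e * m) xz zy em0) (near_nbhs_right _ _ zy)) => w [wW /andP[zw wy]].
  suff : gamma w - e * (V w - V z) <= gamma z by rewrite lerBlDr.
  have : left_lim beta1 r - left_lim beta2 r @[r --> z^'+] --> gamma z.
    rewrite -gj; apply: cvgB; apply: left_lim_cvg_right zab; exact: bv_loc_regulated.
  move=> H; apply: (cvgr_to_ge H).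
  apply: filterS (near_nbhs_right _ _ zw) => x' /andP[zx' x'w].
  have := wW x' zx' x'w; have sx' := lt_trans sz zx'; have wt := lt_trans wy yt.
  rewrite (W0 _ sx' (lt_trans x'w wt)) (W0 _ (lt_trans sx' x'w) wt).
  rewrite subrr add0r -/m normrM (gtr0_norm m0) (mulrC e) -(mulrA m e) ler_pM2l//.
  rewrite ler_norml => /andP[_].
  have : e * (V w - V x') <= e * (V w - V z).
    by rewrite ler_pM2l// lerD2l lerN2; apply: Vnd => //; apply: ltW => //; exact: lt_trans wy.
  exact: le_of_bound.
Qed.

End wronskian.

(** * Uniqueness and signs of solutions *)

Section uniqueness.
Context {R : realType}.
Variables (a b : \bar R) (alpha beta u p : R -> R).
Hypothesis alpha_incr :
  forall x y, oitv a b x -> oitv a b y -> x < y -> alpha x < alpha y.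
Hypothesis omega_neq0 : forall x, oitv a b x -> omega alpha beta x != 0.
Hypothesis sol : solution a b alpha beta u p.
Implicit Types x y z : R.

(** With [u^- = p^- = 0], eliminating [p^+] from the two jump relations leaves [u^+ * omega = 0]. *)
Lemma sol_right_eq0 x : oitv a b x -> left_lim u x = 0 -> left_lim p x = 0 ->
  right_lim u x = 0 /\ right_lim p x = 0.
Proof.
move=> xab u0 p0; have := sol_jump sol x xab; have := sol_djump sol x xab.
rewrite (sol_bal sol x xab) (sol_dbal sol x xab) u0 p0 !subr0 !add0r => pE uE.
have : right_lim u x * omega alpha beta x = 0.
  rewrite /omega; move: (jump _ x) (jump _ x) pE uE => A B pE uE.
  rewrite pE in uE; lra.
move=> /eqP; rewrite mulf_eq0 (negPf (omega_neq0 _ xab)) orbF => /eqP uR0.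
by split => //; rewrite pE uR0 mul0r mul0r.
Qed.

Lemma sol_left_eq0 x : oitv a b x -> right_lim u x = 0 -> right_lim p x = 0 ->
  left_lim u x = 0 /\ left_lim p x = 0.
Proof.
move=> xab u0 p0; have := sol_jump sol x xab; have := sol_djump sol x xab.
rewrite (sol_bal sol x xab) (sol_dbal sol x xab) u0 p0 !sub0r !addr0 => pE uE.
have : left_lim u x * omega alpha beta x = 0.
  rewrite /omega; move: (jump _ x) (jump _ x) pE uE => A B pE uE.
  have pE' : left_lim p x = - (left_lim u x / 2 * B) by rewrite -pE opprK.
  rewrite pE' in uE; lra.
move=> /eqP; rewrite mulf_eq0 (negPf (omega_neq0 _ xab)) orbF => /eqP uL0.
by split => //; apply: oppr_inj; rewrite pE uL0 mul0r mul0r oppr0.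
Qed.

(* Replaces Gronwall: the supremum [M] of [|u| + |p|] satisfies [M <= M / 2]. *)
Lemma contraction_eq0 (l r : R) : (forall z, l < z < r -> oitv a b z) ->
  (forall z, l < z < r -> `|u z| <= 1 /\ `|p z| <= 1) ->
  (forall M, (forall z, l < z < r -> `|u z| <= M /\ `|p z| <= M) ->
    forall z, l < z < r -> `|left_lim u z| <= M / 4 /\ `|left_lim p z| <= M / 4) ->
  forall z, l < z < r -> left_lim u z = 0 /\ left_lim p z = 0.
Proof.
move=> sub bd ctr z0 z0lr.
pose S := [set `|u z| + `|p z| | z in [set z | l < z < r]].
have hS : has_sup S.
  split; first by exists (`|u z0| + `|p z0|), z0.
  by exists 2 => _ [z /bd[? ?] <-]; lra.
pose M := sup S.
have SM z : l < z < r -> `|u z| + `|p z| <= M.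
  by move=> zlr; apply: (ub_le_sup hS.2); exists z.
have bM z : l < z < r -> `|u z| <= M /\ `|p z| <= M.
  move=> /SM; have := normr_ge0 (u z); have := normr_ge0 (p z).
  by split; lra.
have cM := ctr M bM.
have cR z : l < z < r -> `|right_lim u z| <= M / 4 /\ `|right_lim p z| <= M / 4.
  move=> zlr; have zab := sub _ zlr; have /andP[lz zr] := zlr.
  have H : \forall w \near z^'+, `|left_lim u w| <= M / 4 /\ `|left_lim p w| <= M / 4.
    apply: filterS (near_nbhs_right _ _ zr) => w /andP[zw wr].
    by apply: cM; rewrite (lt_trans lz zw).
  split.
    apply: cvgr_to_le (cvg_norm (left_lim_cvg_right _ _ _ (sol_reg sol) _ zab)) _.
    by apply: filterS H => w [].
  apply: cvgr_to_le (cvg_norm (left_lim_cvg_right _ _ _ (sol_dreg sol) _ zab)) _.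
  by apply: filterS H => w [].
have half (x y k : R) : `|x| <= k -> `|y| <= k -> `|(x + y) / 2| <= k.
  by rewrite !ler_norml; lra.
have M0 : 0 <= M by apply: le_trans (SM _ z0lr); rewrite addr_ge0.
(* Values are means of one-sided limits, so [|u|] and [|p|] are each at most [M / 4]. *)
have M2 : M <= M / 2.
  apply: ge_sup; first exact: hS.1.
  move=> _ [z zlr <-]; have zab := sub _ zlr.
  have [uL pL] := cM _ zlr; have [uR pR] := cR _ zlr.
  rewrite (sol_bal sol z zab) (sol_dbal sol z zab).
  have := half _ _ _ uL uR; have := half _ _ _ pL pR; lra.
have M00 : M = 0 by lra.
have [] := cM _ z0lr; rewrite M00 mul0r !normr_le0.
by move=> /eqP -> /eqP ->.
Qed.

(** The increment estimates at [k = 0], with one [V] serving both [u] and [p]. *)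
Lemma variation_bound (c d : R) : oitv a b c -> oitv a b d -> c < d ->
  exists V : R -> R,
    (forall x y, c <= x -> x <= y -> y <= d -> V x <= V y) /\
    forall x y M, c <= x -> x < y -> y <= d ->
      (forall z, x <= z < y -> `|u z| <= M /\ `|p z| <= M) ->
      `|left_lim u y - left_lim u x| <= M * (V y - V x) /\
      `|left_lim p y - left_lim p x| <= M * (V y - V x).
Proof.
move=> cab dab cd; have [V1 [V1B V1p]] := sol_dincr sol _ _ cab dab cd.
have V1nd x y : c <= x -> x <= y -> y <= d -> V1 x <= V1 y.
  move=> cx xy yd; rewrite -subr_ge0; exact: le_trans (normr_ge0 _) (V1B _ _ cx xy yd).
have And x y : c <= x -> x <= y -> y <= d -> left_lim alpha x <= left_lim alpha y.
  move=> cx; rewrite le_eqVlt => /predU1P[->//|xy yd].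
  by apply/ltW/(left_lim_increasing a b) => //; apply: (oitv_cc _ _ _ _ _ cab dab); lra.
exists (fun x => left_lim alpha x + V1 x); split.
  by move=> x y cx xy yd; rewrite lerD ?V1nd ?And.
move=> x y M cx xy yd bM.
have xab : oitv a b x by apply: (oitv_cc _ _ _ _ _ cab dab); lra.
have yab : oitv a b y by apply: (oitv_cc _ _ _ _ _ cab dab); lra.
have M0 : 0 <= M.
  have [|+ _] := bM x; first by rewrite lexx.
  exact: le_trans.
have uM z : x <= z < y -> `|u z - 0| <= M by rewrite subr0 => /bM[].
have pM z : x <= z < y -> `|p z - 0| <= M by rewrite subr0 => /bM[].
have := sol_incr sol _ _ _ _ xab yab xy pM.
have := V1p _ _ _ _ cx xy yd uM.
rewrite !mul0r !subr0 => pV uA.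
have V1d := V1nd _ _ cx (ltW xy) yd; have Ad := And _ _ cx (ltW xy) yd.
split.
  by apply: le_trans uA _; rewrite ler_wpM2l//; lra.
by apply: le_trans pV _; rewrite ler_wpM2l//; lra.
Qed.

Lemma sol_eq0_near_right x : oitv a b x -> right_lim u x = 0 ->
  right_lim p x = 0 ->
  \forall z \near x^'+, left_lim u z = 0 /\ left_lim p z = 0.
Proof.
move=> xab u0 p0; have [d xd dab] := oitv_right _ _ _ xab.
have [V [Vnd VB]] := variation_bound _ _ xab dab xd.
(* [inf S] is the right limit of [V] at [x]. Measuring from it leaves out a jump of [V] at [x], so
   [V] grows by at most [1 / 4] inside a short interval to the right. *)
pose S := [set V w | w in [set w | x < w <= d]].
have hS : has_inf S.
  split; first by exists (V d), d; rewrite //= xd lexx.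
  by exists (V x) => _ [w /andP[xw wd] <-]; exact: Vnd (ltW xw) wd.
have [_ [d' /andP[xd' d'd] <-] d'S] : exists2 y, S y & y < inf S + 1 / 4.
  by apply: inf_adherent => //; lra.
have VV y z : x < y -> y < z -> z < d' -> V z - V y <= 1 / 4.
  move=> xy yz zd'; have : inf S <= V y.
    by apply: ge_inf hS.2 _ _; exists y => //=; rewrite xy; lra.
  by have : V z <= V d' by [apply: Vnd; lra]; lra.
have /near_rightP[r r0 hr] := regulated_near_right _ _ _ (sol_reg sol) _ _ xab ltr01.
have /near_rightP[r' r'0 hr'] := regulated_near_right _ _ _ (sol_dreg sol) _ _ xab ltr01.
pose e := Num.min d' (Num.min (x + r) (x + r')).
have xe : x < e by rewrite !lt_min xd' !ltrDl r0 r'0.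
apply: filterS (near_nbhs_right _ _ xe); apply: contraction_eq0.
- move=> z; rewrite !lt_min => /and3P[xz zd' _].
  by apply: (oitv_cc _ _ _ _ _ xab dab); lra.
- move=> z; rewrite !lt_min => /and4P[xz _ zr zr'].
  have [|] := hr z; first by rewrite xz.
  have [|] := hr' z; first by rewrite xz.
  by rewrite u0 p0 !subr0.
- move=> M bM z /[dup] zxe; rewrite !lt_min => /and4P[xz zd' _ _].
  have zd : z <= d by lra.
  have M0 : 0 <= M by have [+ _] := bM _ zxe; exact: le_trans.
  have H y : x < y -> y < z -> `|left_lim u z - left_lim u y| <= M / 4 /\
      `|left_lim p z - left_lim p y| <= M / 4.
    move=> xy yz; have [|uV pV] := VB y z M (ltW xy) yz zd.
      move=> w /andP[yw wz]; apply: bM; rewrite (lt_le_trans xy yw).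
      by move: zxe => /andP[_]; exact: lt_trans.
    have MV : M * (V z - V y) <= M / 4.
      by rewrite ler_wpM2l// -[leRHS]div1r; exact: VV.
    by split; [exact: le_trans uV MV|exact: le_trans pV MV].
  split.
    have : `|left_lim u z - left_lim u y| @[y --> x^'+] --> `|left_lim u z - right_lim u x|.
      apply: cvg_norm; apply: cvgB; first exact: cvg_cst.
      exact: left_lim_cvg_right (sol_reg sol) _ xab.
    move=> /cvgr_to_le; rewrite u0 subr0; apply.
    by apply: filterS (near_nbhs_right _ _ xz) => y /andP[xy yz]; case: (H y xy yz).
  have : `|left_lim p z - left_lim p y| @[y --> x^'+] --> `|left_lim p z - right_lim p x|.
    apply: cvg_norm; apply: cvgB; first exact: cvg_cst.
    exact: left_lim_cvg_right (sol_dreg sol) _ xab.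
  move=> /cvgr_to_le; rewrite p0 subr0; apply.
  by apply: filterS (near_nbhs_right _ _ xz) => y /andP[xy yz]; case: (H y xy yz).
Qed.

Lemma sol_eq0_near_left x : oitv a b x -> left_lim u x = 0 ->
  left_lim p x = 0 ->
  \forall z \near x^'-, left_lim u z = 0 /\ left_lim p z = 0.
Proof.
move=> xab u0 p0; have [c cx cab] := oitv_left _ _ _ xab.
have [V [Vnd VB]] := variation_bound _ _ cab xab cx.
pose S := [set V w | w in [set w | c <= w < x]].
have hS : has_sup S.
  split; first by exists (V c), c; rewrite //= cx lexx.
  by exists (V x) => _ [w /andP[xw wd] <-]; exact: Vnd xw (ltW wd) _.
have [_ [c' /andP[cc' c'x] <-] c'S] : exists2 y, S y & sup S - 1 / 4 < y.
  by apply: sup_adherent => //; lra.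
have VV y z : c' < y -> y < z -> z < x -> V z - V y <= 1 / 4.
  move=> c'y yz zx; have : V z <= sup S.
    apply: (ub_le_sup hS.2); exists z => //=.
    by rewrite zx andbT; apply: ltW; apply: le_lt_trans cc' (lt_trans c'y yz).
  by have : V c' <= V y by [apply: Vnd; lra]; lra.
have /near_leftP[r r0 hr] := regulated_near_left _ _ _ (sol_reg sol) _ _ xab ltr01.
have /near_leftP[r' r'0 hr'] := regulated_near_left _ _ _ (sol_dreg sol) _ _ xab ltr01.
pose e := Num.max c' (Num.max (x - r) (x - r')).
have ex : e < x by rewrite !gt_max c'x !gtrBl r0 r'0.
apply: filterS (near_nbhs_left _ _ ex); apply: contraction_eq0.
- move=> z; rewrite !gt_max => /andP[/andP[c'z _] zx].
  by apply: (oitv_cc _ _ _ _ _ cab xab); lra.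
- move=> z; rewrite !gt_max => /andP[/and3P[_ zr zr'] zx].
  have [|] := hr z; first by rewrite zr.
  have [|] := hr' z; first by rewrite zr'.
  by rewrite u0 p0 !subr0.
- move=> M bM z /[dup] zxe; rewrite !gt_max => /andP[/andP[c'z _] zx].
  have cz : c <= z by lra.
  have M0 : 0 <= M by have [+ _] := bM _ zxe; exact: le_trans.
  have H y : z < y -> y < x -> `|left_lim u y - left_lim u z| <= M / 4 /\
      `|left_lim p y - left_lim p z| <= M / 4.
    move=> zy yx; have [|uV pV] := VB z y M cz zy (ltW yx).
      move=> w /andP[zw wy]; apply: bM; rewrite (lt_trans wy yx) andbT.
      by move: zxe => /andP[+ _] => /lt_le_trans; apply.
    have MV : M * (V y - V z) <= M / 4.
      by rewrite ler_wpM2l// -[leRHS]div1r; exact: VV.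
    by split; [exact: le_trans uV MV|exact: le_trans pV MV].
  split.
    have : `|left_lim u y - left_lim u z| @[y --> x^'-] --> `|left_lim u x - left_lim u z|.
      apply: cvg_norm; apply: cvgB; last exact: cvg_cst.
      exact: left_lim_cvg_left (sol_reg sol) _ xab.
    move=> /cvgr_to_le; rewrite u0 sub0r normrN; apply.
    by apply: filterS (near_nbhs_left _ _ zx) => y /andP[zy yx]; case: (H y zy yx).
  have : `|left_lim p y - left_lim p z| @[y --> x^'-] --> `|left_lim p x - left_lim p z|.
    apply: cvg_norm; apply: cvgB; last exact: cvg_cst.
    exact: left_lim_cvg_left (sol_dreg sol) _ xab.
  move=> /cvgr_to_le; rewrite p0 sub0r normrN; apply.
  by apply: filterS (near_nbhs_left _ _ zx) => y /andP[zy yx]; case: (H y zy yx).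
Qed.

Lemma sol_left_lim_eq0 x y : oitv a b x -> oitv a b y ->
  left_lim u x = 0 -> left_lim p x = 0 -> left_lim u y = 0 /\ left_lim p y = 0.
Proof.
move=> xab yab ux px; pose P z := left_lim u z = 0 /\ left_lim p z = 0.
have closed_left z w : w < z -> oitv a b z -> (forall r, w <= r -> r < z -> P r) -> P z.
  move=> wz zab Pr.
  have H : \forall r \near z^'-, P r.
    by apply: filterS (near_nbhs_left _ _ wz) => r /andP[wr rz]; apply: Pr => //; exact: ltW.
  split.
    have := left_lim_cvg_left _ _ _ (sol_reg sol) _ zab.
    move/cvg_unique; apply => //; apply: cvg_near_cst; apply: filterS H => r [].
    by [].
  have := left_lim_cvg_left _ _ _ (sol_dreg sol) _ zab.
  move/cvg_unique; apply => //; apply: cvg_near_cst; apply: filterS H => r [].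
  by [].
(* Limits from the right give only [u^+ = p^+ = 0]; [sol_left_eq0] carries this across the possible
   jump at [z]. *)
have closed_right z w : z < w -> oitv a b z -> (forall r, z < r -> r <= w -> P r) -> P z.
  move=> zw zab Pr.
  have H : \forall r \near z^'+, P r.
    by apply: filterS (near_nbhs_right _ _ zw) => r /andP[zr rw]; apply: Pr => //; exact: ltW.
  apply: (sol_left_eq0 _ zab).
    have := left_lim_cvg_right _ _ _ (sol_reg sol) _ zab.
    move/cvg_unique; apply => //; apply: cvg_near_cst; apply: filterS H => r [].
    by [].
  have := left_lim_cvg_right _ _ _ (sol_dreg sol) _ zab.
  move/cvg_unique; apply => //; apply: cvg_near_cst; apply: filterS H => r [].
  by [].
have [xy|/ltW yx] := leP x y.
  apply: (real_induction P x y) => //.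
  - move=> z xz zy [uz pz].
    have zab : oitv a b z by apply: (oitv_cc _ _ _ _ _ xab yab); lra.
    by have [uR pR] := sol_right_eq0 _ zab uz pz; exact: sol_eq0_near_right.
  - move=> z xz zy; apply: closed_left => //.
    by apply: (oitv_cc _ _ _ _ _ xab yab); lra.
apply: (real_induction_left P y x) => //.
- move=> z yz zx [uz pz]; apply: sol_eq0_near_left => //.
  by apply: (oitv_cc _ _ _ _ _ yab xab); lra.
- move=> z yz zx; apply: closed_right => //.
  by apply: (oitv_cc _ _ _ _ _ yab xab); lra.
Qed.

Hypothesis u_nontrivial : nontrivial a b u.

Lemma sol_left_neq0 x : oitv a b x -> left_lim u x = 0 -> left_lim p x != 0.
Proof.
move=> xab ux; apply/eqP => px; have [y yab /eqP] := u_nontrivial; apply.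
have [uy py] := sol_left_lim_eq0 _ _ xab yab ux px.
have [uR _] := sol_right_eq0 _ yab uy py.
by rewrite (sol_bal sol y yab) uy uR addr0 mul0r.
Qed.

Lemma sol_right_neq0 x : oitv a b x -> right_lim u x = 0 -> right_lim p x != 0.
Proof.
move=> xab ux; apply/eqP => px; have [ul pl] := sol_left_eq0 _ xab ux px.
by have := sol_left_neq0 _ xab ul; rewrite pl eqxx.
Qed.

End uniqueness.

(** * Signs of a solution beside a point *)

Section signs.
Context {R : realType}.
Variables (a b : \bar R).
Implicit Types (alpha beta u v p q : R -> R) (x y z : R).

(** The sign is read beside [x] and not at [x], so it makes sense at a zero; a nontrivial solution
    has such a sign on each side of every point. *)
Definition pos_right u x :=
  \forall z \near x^'+, 0 < left_lim u z /\ 0 < right_lim u z.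

Definition pos_left u x :=
  \forall z \near x^'-, 0 < left_lim u z /\ 0 < right_lim u z.

Let incrN (r r' k d : R) : - r - - r' - k * d = - (r - r' - - k * d).
Proof. by ring. Qed.

Lemma solutionN alpha beta u p : solution a b alpha beta u p ->
  solution a b alpha beta (\- u) (\- p).
Proof.
move=> sol; have ru := sol_reg sol; have rp := sol_dreg sol.
have normN (r k : R) : `|- r - k| = `|r - (- k)| by rewrite -normrN; congr `|_|; ring.
split.
- exact: regulatedN.
- exact: regulatedN.
- move=> x xab; have := sol_bal sol x xab.
  rewrite (left_limN a b)// (right_limN a b)//=; lra.
- move=> x xab; have := sol_dbal sol x xab.
  rewrite (left_limN a b)// (right_limN a b)//=; lra.
- move=> x xab; have := sol_jump sol x xab.
  rewrite (left_limN a b)// (right_limN a b)//= mulNr => <-; ring.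
- move=> x xab; have := sol_djump sol x xab.
  rewrite (left_limN a b)// (right_limN a b)//= mulNr => <-; ring.
- move=> x y k M xab yab xy pM; rewrite !(left_limN a b)//.
  have H := sol_incr sol x y (- k) M xab yab xy.
  by rewrite incrN normrN; apply: H => z /pM; rewrite normN.
- move=> c d cab dab cd; have [V [VB Vp]] := sol_dincr sol _ _ cab dab cd.
  exists V; split => // x y k M cx xy yd uM.
  have xab : oitv a b x by apply: (oitv_cc _ _ _ _ _ cab dab); lra.
  have yab : oitv a b y by apply: (oitv_cc _ _ _ _ _ cab dab); lra.
  rewrite !(left_limN a b)//.
  have H := Vp x y (- k) M cx xy yd.
  by rewrite incrN normrN; apply: H => z /uM; rewrite normN.
Qed.

Lemma nontrivialN u : nontrivial a b u -> nontrivial a b (\- u).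
Proof. by move=> [x xab ux]; exists x => //=; rewrite oppr_eq0. Qed.

Lemma pos_rightN u x : regulated a b u -> oitv a b x ->
  pos_right u x -> ~ pos_right (\- u) x.
Proof.
move=> ru xab up um; suff : \forall z \near x^'+, False.
  by move=> /near_rightP[e e0 /(_ (x + e / 2))]; apply; lra.
apply: filterS (filterI (near_right_oitv _ _ _ xab) (filterI up um)) => z [zab] /=.
by rewrite (left_limN a b)// => -[[? _] [? _]]; lra.
Qed.

Lemma pos_leftN u x : regulated a b u -> oitv a b x ->
  pos_left u x -> ~ pos_left (\- u) x.
Proof.
move=> ru xab up um; suff : \forall z \near x^'-, False.
  by move=> /near_leftP[e e0 /(_ (x - e / 2))]; apply; lra.
apply: filterS (filterI (near_left_oitv _ _ _ xab) (filterI up um)) => z [zab] /=.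
by rewrite (left_limN a b)// => -[[? _] [? _]]; lra.
Qed.

Lemma pos_right_ge0 u x : regulated a b u -> oitv a b x -> pos_right u x ->
  0 <= right_lim u x.
Proof.
move=> ru xab up; apply: cvgr_to_ge (left_lim_cvg_right _ _ _ ru _ xab) _.
by apply: filterS up => z [/ltW].
Qed.

Lemma pos_left_ge0 u x : regulated a b u -> oitv a b x -> pos_left u x ->
  0 <= left_lim u x.
Proof.
move=> ru xab up; apply: cvgr_to_ge (left_lim_cvg_left _ _ _ ru _ xab) _.
by apply: filterS up => z [/ltW].
Qed.

Let ge_of_near (r k d : R) : `|r - k * d| <= k / 2 * d -> k / 2 * d <= r.
Proof. by rewrite ler_norml => /andP[+ _]; lra. Qed.

Let le_of_near (r k d : R) : `|- r - k * d| <= - k / 2 * d -> - k / 2 * d <= r.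
Proof. by rewrite ler_norml => /andP[_]; lra. Qed.

Section one_solution.
Variables (alpha beta u p : R -> R).
Hypothesis alpha_incr :
  forall x y, oitv a b x -> oitv a b y -> x < y -> alpha x < alpha y.
Hypothesis sol : solution a b alpha beta u p.

(** In the second case [p] exceeds half its right limit near [x], so [u] grows at least like a
    positive multiple of [alpha], which is strictly increasing. *)
Lemma pos_rightP x : oitv a b x ->
  0 < right_lim u x \/ (right_lim u x = 0 /\ 0 < right_lim p x) -> pos_right u x.
Proof.
move=> xab [u0|[u0 p0]].
  have u2 : 0 < right_lim u x / 2 by rewrite divr_gt0.
  apply: filterS (regulated_near_right _ _ _ (sol_reg sol) _ _ xab u2) => z [_].
  rewrite !ler_norml => /andP[? _] /andP[? _]; split; lra.
set k := right_lim p x in p0; have k0 : 0 < k / 2 by rewrite divr_gt0.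
have /near_rightP[r r0 hr] : \forall z \near x^'+, oitv a b z /\ `|p z - k| <= k / 2.
  apply: filterI; first exact: near_right_oitv.
  by apply: filterS (regulated_near_right _ _ _ (sol_dreg sol) _ _ xab k0) => z [].
have mono y z : x < y -> y < z -> z < x + r ->
    left_lim u y + k / 2 * (left_lim alpha z - left_lim alpha y) <= left_lim u z.
  move=> xy yz zr.
  have yab : oitv a b y by apply: (hr y _).1; lra.
  have zab : oitv a b z by apply: (hr z _).1; lra.
  have pk w : y <= w < z -> `|p w - k| <= k / 2.
    by move=> /andP[yw wz]; apply: (hr w _).2; lra.
  by rewrite addrC -lerBrDr; apply: ge_of_near (sol_incr sol _ _ _ _ yab zab yz pk).
apply/near_rightP; exists r => // z /andP[xz zr].
have zab : oitv a b z by apply: (hr z _).1; rewrite xz.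
have uz : 0 < left_lim u z.
  have : k / 2 * (left_lim alpha z - right_lim alpha x) <= left_lim u z.
    (* An increment over [[x, z[] would include the jump at [x], so [y] is sent to [x] from the
       right instead. *)
    have H : left_lim u y + k / 2 * (left_lim alpha z - left_lim alpha y) @[y --> x^'+] -->
        right_lim u x + k / 2 * (left_lim alpha z - right_lim alpha x).
      apply: cvgD; first exact: left_lim_cvg_right (sol_reg sol) _ xab.
      apply: cvgM; first exact: cvg_cst.
      apply: cvgB; first exact: cvg_cst.
      exact: left_lim_cvg_right (increasing_regulated _ _ _ alpha_incr) _ xab.
    move: H => /cvgr_to_le; rewrite u0 add0r; apply.
    by apply: filterS (near_nbhs_right _ _ xz) => y /andP[xy yz]; exact: mono.
  apply: lt_le_trans; rewrite mulr_gt0// subr_gt0.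
  exact: (right_lim_lt_left_lim a b).
split => //; apply: lt_le_trans uz _.
apply: cvgr_to_ge (left_lim_cvg_right _ _ _ (sol_reg sol) _ zab) _.
apply: filterS (filterI (near_right_oitv _ _ _ zab) (near_nbhs_right _ _ zr)).
move=> w [wab /andP[zw wr]].
apply: le_trans (mono z w xz zw wr); rewrite lerDl mulr_ge0 ?(ltW k0)//.
by rewrite subr_ge0; apply/ltW/(left_lim_increasing a b).
Qed.

Lemma pos_leftP x : oitv a b x ->
  0 < left_lim u x \/ (left_lim u x = 0 /\ left_lim p x < 0) -> pos_left u x.
Proof.
move=> xab [u0|[u0 p0]].
  have u2 : 0 < left_lim u x / 2 by rewrite divr_gt0.
  apply: filterS (regulated_near_left _ _ _ (sol_reg sol) _ _ xab u2) => z [_].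
  rewrite !ler_norml => /andP[? _] /andP[? _]; split; lra.
set k := left_lim p x in p0; have k0 : 0 < - k / 2 by rewrite divr_gt0 ?oppr_gt0.
have /near_leftP[r r0 hr] : \forall z \near x^'-, oitv a b z /\ `|p z - k| <= - k / 2.
  apply: filterI; first exact: near_left_oitv.
  by apply: filterS (regulated_near_left _ _ _ (sol_dreg sol) _ _ xab k0) => z [].
have mono z : x - r < z -> z < x ->
    - k / 2 * (left_lim alpha x - left_lim alpha z) <= left_lim u z.
  move=> rz zx.
  have zab : oitv a b z by apply: (hr z _).1; rewrite rz.
  have pk w : z <= w < x -> `|p w - k| <= - k / 2.
    by move=> /andP[zw wx]; apply: (hr w _).2; lra.
  have := sol_incr sol _ _ _ _ zab xab zx pk; rewrite u0 sub0r; exact: le_of_near.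
apply/near_leftP; exists r => // z /andP[rz zx].
have zab : oitv a b z by apply: (hr z _).1; rewrite rz.
split.
  apply: lt_le_trans (mono z rz zx); rewrite mulr_gt0// subr_gt0.
  exact: (left_lim_increasing a b).
have : - k / 2 * (left_lim alpha x - right_lim alpha z) <= right_lim u z.
  have H : - k / 2 * (left_lim alpha x - left_lim alpha w) @[w --> z^'+] -->
      - k / 2 * (left_lim alpha x - right_lim alpha z).
    apply: cvgM; first exact: cvg_cst.
    apply: cvgB; first exact: cvg_cst.
    exact: left_lim_cvg_right (increasing_regulated _ _ _ alpha_incr) _ zab.
  apply: ler_cvg_to H (left_lim_cvg_right _ _ _ (sol_reg sol) _ zab) _.
  apply: filterS (near_nbhs_right _ _ zx) => w /andP[zw wx]; apply: mono => //.
  exact: lt_trans zw.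
apply: lt_le_trans; rewrite mulr_gt0// subr_gt0.
exact: (right_lim_lt_left_lim a b).
Qed.

End one_solution.

Section nontrivial_solution.
Variables (alpha beta : R -> R).
Hypothesis alpha_incr :
  forall x y, oitv a b x -> oitv a b y -> x < y -> alpha x < alpha y.
Hypothesis omega_neq0 : forall x, oitv a b x -> omega alpha beta x != 0.

(** If [u^+ = 0], uniqueness gives [p^+ != 0], and the sign of [p^+] decides. *)
Lemma pos_right_or u p x : solution a b alpha beta u p -> nontrivial a b u ->
  oitv a b x -> pos_right u x \/ pos_right (\- u) x.
Proof.
move=> sol nt xab; have solN := solutionN _ _ _ _ sol.
have pR := sol_right_neq0 _ _ _ _ _ _ alpha_incr omega_neq0 sol nt x xab.
have [uR|uR|uR] := ltgtP (right_lim u x) 0.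
- right; apply: (pos_rightP _ _ _ _ alpha_incr solN) => //; left.
  by rewrite (right_limN a b)//; [lra|exact: sol_reg sol].
- by left; apply: (pos_rightP _ _ _ _ alpha_incr sol) => //; left.
- have := pR uR; rewrite neq_lt => /orP[p0|p0].
    right; apply: (pos_rightP _ _ _ _ alpha_incr solN) => //; right.
    rewrite !(right_limN a b)//; [|exact: sol_dreg sol|exact: sol_reg sol].
    by rewrite uR oppr0 oppr_gt0.
  by left; apply: (pos_rightP _ _ _ _ alpha_incr sol) => //; right.
Qed.

Lemma pos_left_or u p x : solution a b alpha beta u p -> nontrivial a b u ->
  oitv a b x -> pos_left u x \/ pos_left (\- u) x.
Proof.
move=> sol nt xab; have solN := solutionN _ _ _ _ sol.
have pR := sol_left_neq0 _ _ _ _ _ _ alpha_incr omega_neq0 sol nt x xab.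
have [uR|uR|uR] := ltgtP (left_lim u x) 0.
- right; apply: (pos_leftP _ _ _ _ alpha_incr solN) => //; left.
  by rewrite (left_limN a b)//; [lra|exact: sol_reg sol].
- by left; apply: (pos_leftP _ _ _ _ alpha_incr sol) => //; left.
- have := pR uR; rewrite neq_lt => /orP[p0|p0].
    by left; apply: (pos_leftP _ _ _ _ alpha_incr sol) => //; right.
  right; apply: (pos_leftP _ _ _ _ alpha_incr solN) => //; right.
  rewrite !(left_limN a b)//; [|exact: sol_dreg sol|exact: sol_reg sol].
  by rewrite uR oppr0 oppr_lt0.
Qed.

Lemma pos_right_derivative u p x : solution a b alpha beta u p ->
  nontrivial a b u -> oitv a b x -> pos_right u x -> right_lim u x = 0 ->
  0 < right_lim p x.
Proof.
move=> sol nt xab up u0; have solN := solutionN _ _ _ _ sol.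
have := sol_right_neq0 _ _ _ _ _ _ alpha_incr omega_neq0 sol nt x xab u0.
rewrite neq_lt => /orP[p0|//].
exfalso; apply: (pos_rightN u x (sol_reg sol) xab up).
apply: (pos_rightP _ _ _ _ alpha_incr solN) => //; right.
rewrite !(right_limN a b)//; [|exact: sol_dreg sol|exact: sol_reg sol].
by rewrite u0 oppr0 oppr_gt0.
Qed.

Lemma pos_left_derivative u p x : solution a b alpha beta u p ->
  nontrivial a b u -> oitv a b x -> pos_left u x -> left_lim u x = 0 ->
  left_lim p x < 0.
Proof.
move=> sol nt xab up u0; have solN := solutionN _ _ _ _ sol.
have := sol_left_neq0 _ _ _ _ _ _ alpha_incr omega_neq0 sol nt x xab u0.
rewrite neq_lt => /orP[//|p0].
exfalso; apply: (pos_leftN u x (sol_reg sol) xab up).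
apply: (pos_leftP _ _ _ _ alpha_incr solN) => //; right.
rewrite !(left_limN a b)//; [|exact: sol_dreg sol|exact: sol_reg sol].
by rewrite u0 oppr0 oppr_lt0.
Qed.

(* The jump relations give [right_lim u x * omega x = jump alpha x * left_lim p x]
   when [left_lim u x = 0]. *)
Lemma pos_right_crossing u p x : solution a b alpha beta u p ->
  nontrivial a b u -> oitv a b x -> pos_right u x -> left_lim u x = 0 ->
  0 < omega alpha beta x -> 0 < left_lim p x.
Proof.
move=> sol nt xab up u0 om.
have pL := sol_left_neq0 _ _ _ _ _ _ alpha_incr omega_neq0 sol nt x xab u0.
have uR := pos_right_ge0 _ _ (sol_reg sol) xab up.
have pR := pos_right_derivative _ _ _ sol nt xab up.
have A0 := jump_increasing_ge0 _ _ _ alpha_incr _ xab.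
have := sol_jump sol x xab; have := sol_djump sol x xab.
rewrite (sol_bal sol x xab) (sol_dbal sol x xab) u0 subr0 add0r => pE uE.
have key : right_lim u x * omega alpha beta x = jump alpha x * left_lim p x.
  rewrite /omega; move: (jump _ x) (jump _ x) pE uE => A B pE uE.
  have pRE : right_lim p x = left_lim p x + right_lim u x / 2 * B by lra.
  rewrite pRE in uE; lra.
(* If [alpha] does not jump, then [u] vanishes at [x], so [p] does not jump either and
   [p^- = p^+ > 0]. *)
have [A1|A1] := eqVneq (jump alpha x) 0.
  have uR0 : right_lim u x = 0 by rewrite uE A1 mulr0.
  by have := pR uR0; move: pE; rewrite uR0 !mul0r => /eqP; rewrite subr_eq0 => /eqP ->.
have Agt : 0 < jump alpha x by rewrite lt_neqAle eq_sym A1.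
rewrite lt_neqAle eq_sym pL /= -(pmulr_rge0 _ Agt) -key.
by rewrite mulr_ge0// ltW.
Qed.

(** The mirror relation is [left_lim u x * omega x = - (jump alpha x * right_lim p x)] when
    [right_lim u x = 0]. *)
Lemma pos_left_crossing u p x : solution a b alpha beta u p ->
  nontrivial a b u -> oitv a b x -> pos_left u x -> right_lim u x = 0 ->
  0 < omega alpha beta x -> right_lim p x < 0.
Proof.
move=> sol nt xab up u0 om.
have pR := sol_right_neq0 _ _ _ _ _ _ alpha_incr omega_neq0 sol nt x xab u0.
have uL := pos_left_ge0 _ _ (sol_reg sol) xab up.
have pL := pos_left_derivative _ _ _ sol nt xab up.
have A0 := jump_increasing_ge0 _ _ _ alpha_incr _ xab.
have := sol_jump sol x xab; have := sol_djump sol x xab.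
rewrite (sol_bal sol x xab) (sol_dbal sol x xab) u0 sub0r addr0 => pE uE.
have key : left_lim u x * omega alpha beta x = - (jump alpha x * right_lim p x).
  rewrite /omega; move: (jump _ x) (jump _ x) pE uE => A B pE uE.
  have pLE : left_lim p x = right_lim p x - left_lim u x / 2 * B by lra.
  rewrite pLE in uE; lra.
have [A1|A1] := eqVneq (jump alpha x) 0.
  have uL0 : left_lim u x = 0 by apply: oppr_inj; rewrite uE A1 mulr0 oppr0.
  by have := pL uL0; move: pE; rewrite uL0 !mul0r => /eqP; rewrite subr_eq0 => /eqP ->.
have Agt : 0 < jump alpha x by rewrite lt_neqAle eq_sym A1.
rewrite lt_neqAle pR /= -(pmulr_rle0 _ Agt) -oppr_ge0 -key.
by rewrite mulr_ge0// ltW.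
Qed.

Lemma pos_right_near u x : pos_right u x -> \forall z \near x^'+, pos_right u z.
Proof.
move=> /near_rightP[e e0 he]; apply/near_rightP; exists e => // z /andP[xz ze].
apply: filterS (near_nbhs_right _ _ ze) => w /andP[zw we].
by apply: he; rewrite (lt_trans xz zw).
Qed.

Lemma pos_left_of_pos_right u p x y : solution a b alpha beta u p ->
  nontrivial a b u -> oitv a b x -> oitv a b y -> x < y ->
  (forall z, x < z -> z < y -> pos_right u z) -> pos_left u y.
Proof.
move=> sol nt xab yab xy up.
have [//|/near_leftP[e e0 he]] := pos_left_or _ _ _ sol nt yab.
have ru := sol_reg sol.
have [z [xz ez zy]] : exists z, [/\ x < z, y - e < z & z < y].
  exists ((Num.max x (y - e) + y) / 2).
  have : Num.max x (y - e) < y by rewrite gt_max xy gtrBl.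
  have : x <= Num.max x (y - e) by rewrite le_max lexx.
  have : y - e <= Num.max x (y - e) by rewrite le_max lexx orbT.
  by split; lra.
have zab : oitv a b z by apply: (oitv_cc _ _ _ _ _ xab yab); lra.
exfalso; apply: (pos_rightN _ _ ru zab (up z xz zy)).
apply: filterS (near_nbhs_right _ _ zy) => w /andP[zw wy].
by apply: he; rewrite (lt_trans ez zw).
Qed.

Lemma pos_right_of_pos_right u p x y : solution a b alpha beta u p ->
  nontrivial a b u -> oitv a b x -> oitv a b y -> x < y ->
  (forall z, x < z -> z < y -> pos_right u z) -> pos_right u x.
Proof.
move=> sol nt xab yab xy up.
have [//|um] := pos_right_or _ _ _ sol nt xab.
suff : \forall z \near x^'+, False.
  by move=> /near_rightP[e e0 /(_ (x + e / 2))] F; exfalso; apply: F; lra.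
apply: filterS (filterI (pos_right_near _ _ um) (near_nbhs_right _ _ xy)) => z.
move=> [/= uz /andP[xz zy]].
have zab : oitv a b z by apply: (oitv_cc _ _ _ _ _ xab yab); lra.
exact: (pos_rightN _ _ (sol_reg sol) zab (up z xz zy)).
Qed.

(** Real induction: [pos_right] persists a little to the right by definition, and at a limit point
    it gives [pos_left], which the hypothesis turns into [pos_right]. *)
Lemma pos_right_propagate u p x y : solution a b alpha beta u p ->
  nontrivial a b u -> oitv a b x -> oitv a b y -> x <= y ->
  (forall z, x < z -> z <= y -> pos_left u z -> pos_right u z) ->
  pos_right u x -> pos_right u y.
Proof.
move=> sol nt xab yab xy lr ux; apply: (real_induction (pos_right u) x y) => //.
  by move=> z _ _; exact: pos_right_near.
move=> z xz zy uz; apply: lr => //.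
have zab : oitv a b z by apply: (oitv_cc _ _ _ _ _ xab yab); lra.
apply: (pos_left_of_pos_right _ _ _ _ sol nt xab zab xz) => w xw.
by apply: uz; exact: ltW.
Qed.

Lemma no_sign_change u p x : solution a b alpha beta u p ->
  nontrivial a b u -> oitv a b x -> ~ changes_sign_at a b u x ->
  (pos_left u x -> pos_right u x) /\ (pos_left (\- u) x -> pos_right (\- u) x).
Proof.
move=> sol nt xab ncs; have ru := sol_reg sol.
have cs : (pos_left u x /\ pos_right (\- u) x) \/ (pos_left (\- u) x /\ pos_right u x) ->
    changes_sign_at a b u x.
  move=> H; split => //.
  have /near_leftP[l l0 hl] := near_left_oitv _ _ _ xab.
  have /near_rightP[r r0 hr] := near_right_oitv _ _ _ xab.
  have dom e : e <= l -> e <= r -> `]x - e, x + e[ `<=` oitv a b.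
    move=> el er z; rewrite /= in_itv/= => /andP[xz zx].
    have [zx'|xz'|->//] := ltgtP z x; [apply: hl|apply: hr]; lra.
  case: H => -[/near_leftP[e e0 he] /near_rightP[e' e'0 he']];
    exists (Num.min (Num.min e e') (Num.min l r)); rewrite ?lt_min ?e0 ?e'0 ?l0//;
    have [me [me' [ml mr]]] : Num.min (Num.min e e') (Num.min l r) <= e /\
      Num.min (Num.min e e') (Num.min l r) <= e' /\
      Num.min (Num.min e e') (Num.min l r) <= l /\
      Num.min (Num.min e e') (Num.min l r) <= r
      by rewrite !ge_min !lexx !orbT.
  - split; [exact: dom|right]; split => z /andP[xz zx].
      by have [|] := he z; [lra|].
    have [|_] := he' z; first lra.
    by rewrite (right_limN a b)//; [lra|apply: hr; lra].
  - split; [exact: dom|left]; split => z /andP[xz zx].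
      have [|+ _] := he z; first lra.
      by rewrite (left_limN a b)//; [lra|apply: hl; lra].
    by have [|] := he' z; [lra|].
split=> ul; have [ur|ur] := pos_right_or _ _ _ sol nt xab => //.
  by exfalso; apply/ncs/cs; left.
by exfalso; apply/ncs/cs; right.
Qed.

(** A sign at one point of [I] spreads to the right. It spreads to the left by contradiction, since
    the opposite sign at an earlier point would itself spread to the right. *)
Lemma sign_const u p (I : set R) : solution a b alpha beta u p ->
  nontrivial a b u -> I `<=` oitv a b ->
  is_interval I ->
  (forall x, I x -> ~ changes_sign_at a b u x) ->
  (forall x, I x -> pos_left u x /\ pos_right u x) \/
  (forall x, I x -> pos_left (\- u) x /\ pos_right (\- u) x).
Proof.
move=> sol nt Iab Icvx ncs.
have solN := solutionN _ _ _ _ sol; have ntN := nontrivialN _ nt.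
have ru := sol_reg sol.
have lr x Ix := no_sign_change _ _ x sol nt (Iab x Ix) (ncs x Ix).
have rl x : I x -> pos_right u x -> pos_left u x.
  move=> Ix ux; have [//|um] := pos_left_or _ _ _ sol nt (Iab x Ix).
  by have := pos_rightN _ _ ru (Iab x Ix) ux; case; exact: (lr x Ix).2.
have rlN x : I x -> pos_right (\- u) x -> pos_left (\- u) x.
  move=> Ix um; have [ux|//] := pos_left_or _ _ _ sol nt (Iab x Ix).
  by exfalso; apply: (pos_rightN _ _ ru (Iab x Ix) _ um); exact: (lr x Ix).1.
have prop x y : I x -> I y -> x <= y -> pos_right u x -> pos_right u y.
  move=> Ix Iy xy; apply: (pos_right_propagate _ _ _ _ sol nt (Iab x Ix) (Iab y Iy) xy).
  by move=> z xz zy; apply: (lr z _).1; apply: (Icvx x y) => //; rewrite (ltW xz).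
have propN x y : I x -> I y -> x <= y -> pos_right (\- u) x -> pos_right (\- u) y.
  move=> Ix Iy xy; apply: (pos_right_propagate _ _ _ _ solN ntN (Iab x Ix) (Iab y Iy) xy).
  by move=> z xz zy; apply: (lr z _).2; apply: (Icvx x y) => //; rewrite (ltW xz).
have [[x Ix]|I0] := pselect (exists x, I x); last first.
  by left=> x Ix; exfalso; apply: I0; exists x.
have [ux|ux] := pos_right_or _ _ _ sol nt (Iab x Ix).
  left=> y Iy; suff uy : pos_right u y by split => //; exact: rl.
  have [xy|/ltW yx] := leP x y; first exact: prop ux.
  have [//|uy] := pos_right_or _ _ _ sol nt (Iab y Iy).
  by have := pos_rightN _ _ ru (Iab x Ix) ux; case; exact: propN uy.
right=> y Iy; suff uy : pos_right (\- u) y by split => //; exact: rlN.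
have [xy|/ltW yx] := leP x y; first exact: propN ux.
have [uy|//] := pos_right_or _ _ _ sol nt (Iab y Iy).
by exfalso; apply: (pos_rightN _ _ ru (Iab x Ix) _ ux); exact: prop uy.
Qed.

End nontrivial_solution.
End signs.

(** * Comparison *)

Section positive_generator.
Context {R : realType}.
Variables (a b : \bar R) (beta1 beta2 : R -> R) (I : set R).
Hypotheses (beta1_bv : bv_loc a b beta1) (beta2_bv : bv_loc a b beta2).
Hypothesis pos : positive_on a b (beta1 \- beta2) I.
Implicit Types x y : R.

Lemma bv_locB : bv_loc a b (beta1 \- beta2).
Proof.
move=> c d cab dab; rewrite le_eqVlt => /predU1P[->|cd].
  apply: nondecreasing_bounded_variation => x y; rewrite !in_itv/= => dx dy _.
  by have -> : x = y by lra.
apply: bounded_variationD => //; first exact: beta1_bv (ltW cd).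
by apply/bounded_variationN; exact: beta2_bv (ltW cd).
Qed.

Lemma positive_on_incr x y : oitv a b x -> oitv a b y -> x <= y ->
  (forall z, x <= z < y -> I z) ->
  left_lim beta1 x - left_lim beta2 x <= left_lim beta1 y - left_lim beta2 y.
Proof.
move=> xab yab; rewrite le_eqVlt => /predU1P[->//|xy] subI.
have W : in_window a b x y `[x, y[ by split.
have := @pos _ _ _ W subI => /fine_ge0.
rewrite (stieltjes_co a b _ _ _ bv_locB xab yab _ _ xy (lexx x) (ltW xy) (lexx y)).
have r1 := bv_loc_regulated _ _ _ beta1_bv; have r2 := bv_loc_regulated _ _ _ beta2_bv.
by rewrite (left_limB _ _ _ _ _ r1 r2 xab) (left_limB _ _ _ _ _ r1 r2 yab) subr_ge0.
Qed.

Lemma positive_on_jump x : oitv a b x -> I x -> 0 <= jump beta1 x - jump beta2 x.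
Proof.
move=> xab Ix; have [d xd dab] := oitv_right _ _ _ xab.
have W : in_window a b x d [set x].
  by split=> // _ /= ->; rewrite in_itv/= lexx.
have := @pos _ _ _ W; rewrite sub1set inE => /(_ Ix)/fine_ge0.
rewrite (stieltjes_set1 a b _ _ _ bv_locB xab dab _ xd (lexx x) xd) /jump.
have r1 := bv_loc_regulated _ _ _ beta1_bv; have r2 := bv_loc_regulated _ _ _ beta2_bv.
rewrite (left_limB _ _ _ _ _ r1 r2 xab) (right_limB _ _ _ _ _ r1 r2 xab).
by rewrite !opprD addrACA.
Qed.

End positive_generator.

(** * Two solutions without sign change on a common interval *)

Section comparison.
Context {R : realType}.
Variables (a b : \bar R) (alpha beta1 beta2 u v p q : R -> R) (I : set R).
Hypothesis alpha_incr :
  forall x y, oitv a b x -> oitv a b y -> x < y -> alpha x < alpha y.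
Hypotheses (beta1_bv : bv_loc a b beta1) (beta2_bv : bv_loc a b beta2).
Hypothesis omega1_neq0 : forall x, oitv a b x -> omega alpha beta1 x != 0.
Hypothesis omega2_neq0 : forall x, oitv a b x -> omega alpha beta2 x != 0.
Hypotheses (u_sol : solution a b alpha beta1 u p)
  (v_sol : solution a b alpha beta2 v q).
Hypotheses (u_nontrivial : nontrivial a b u) (v_nontrivial : nontrivial a b v).
Hypothesis pos : positive_on a b (beta1 \- beta2) I.
Variables s t : R.
Hypotheses (sab : oitv a b s) (tab : oitv a b t) (st : s < t).
Hypothesis sub_I : forall x, s < x -> x < t -> I x.
Hypothesis u_pos : forall x, s < x -> x < t -> pos_left u x /\ pos_right u x.
Hypothesis u_neq0 : forall x, s < x -> x < t -> 0 < left_lim u x * right_lim u x.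
Hypothesis v_pos : forall x, I x -> pos_left v x /\ pos_right v x.

Let W := wronskian_left u v p q.
Let WR := wronskian_right u v p q.

Let in_ab x : s <= x <= t -> oitv a b x.
Proof. exact: (oitv_cc _ _ _ _ _ sab tab). Qed.

Let u_gt0 x : s < x -> x < t -> 0 < left_lim u x /\ 0 < right_lim u x.
Proof.
move=> sx xt; have xab : oitv a b x by apply: in_ab; lra.
have [ul ur] := u_pos x sx xt; have := u_neq0 x sx xt.
have := pos_left_ge0 _ _ _ _ (sol_reg u_sol) xab ul.
have := pos_right_ge0 _ _ _ _ (sol_reg u_sol) xab ur.
rewrite !le_eqVlt => /predU1P[<-|u1] /predU1P[<-|u2]; rewrite ?mul0r ?mulr0 ?ltxx//.
Qed.

Let v_ge0 x : s <= x <= t -> I x -> 0 <= left_lim v x /\ 0 <= right_lim v x.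
Proof.
move=> /in_ab xab /v_pos[vl vr]; split.
  exact: (pos_left_ge0 _ _ _ _ (sol_reg v_sol) xab vl).
exact: (pos_right_ge0 _ _ _ _ (sol_reg v_sol) xab vr).
Qed.

Let us : pos_right u s.
Proof.
apply: (pos_right_of_pos_right _ _ _ _ alpha_incr omega1_neq0 _ _ _ _ u_sol
  u_nontrivial sab tab st) => z sz zt.
exact: (u_pos z sz zt).2.
Qed.

Let ut : pos_left u t.
Proof.
apply: (pos_left_of_pos_right _ _ _ _ alpha_incr omega1_neq0 _ _ _ _ u_sol
  u_nontrivial sab tab st) => z sz zt.
exact: (u_pos z sz zt).2.
Qed.

Let vs : pos_right v s.
Proof.
apply: (pos_right_of_pos_right _ _ _ _ alpha_incr omega2_neq0 _ _ _ _ v_sol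
  v_nontrivial sab tab st) => z sz zt.
exact: (v_pos z (sub_I z sz zt)).2.
Qed.

Let vt : pos_left v t.
Proof.
apply: (pos_left_of_pos_right _ _ _ _ alpha_incr omega2_neq0 _ _ _ _ v_sol
  v_nontrivial sab tab st) => z sz zt.
exact: (v_pos z (sub_I z sz zt)).2.
Qed.

Let usR : 0 <= right_lim u s.
Proof. exact: (pos_right_ge0 _ _ _ _ (sol_reg u_sol) sab us). Qed.

Let utL : 0 <= left_lim u t.
Proof. exact: (pos_left_ge0 _ _ _ _ (sol_reg u_sol) tab ut). Qed.

Let vsR : 0 <= right_lim v s.
Proof. exact: (pos_right_ge0 _ _ _ _ (sol_reg v_sol) sab vs). Qed.

Let vtL : 0 <= left_lim v t.
Proof. exact: (pos_left_ge0 _ _ _ _ (sol_reg v_sol) tab vt). Qed.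

Let jump_uv x : s <= x <= t -> I x -> 0 <= left_lim u x -> 0 <= right_lim u x ->
  0 <= u x * v x * (jump beta1 x - jump beta2 x).
Proof.
move=> sxt Ix ul ur; have xab := in_ab _ sxt; have [vl vr] := v_ge0 _ sxt Ix.
rewrite mulr_ge0 ?(positive_on_jump a b beta1 beta2 I)//.
by rewrite (sol_bal u_sol x xab) (sol_bal v_sol x xab) mulr_ge0// divr_ge0// addr_ge0.
Qed.

(** Starting at [s] includes the jump of [W] at [s], which has the right sign only if [s] lies in
    [I] and [u^-] is nonnegative there. *)
Let W_le x y : s <= x -> x <= y -> y <= t ->
  (x = s -> I s /\ 0 <= left_lim u s) -> W y <= W x.
Proof.
move=> sx xy yt xs.
have [xab yab] : oitv a b x /\ oitv a b y by split; apply: in_ab; lra.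
have H z : x <= z -> z < y -> [/\ I z, 0 <= left_lim u z & 0 <= right_lim u z].
  move=> xz zy; have [sz|zs|sz] := ltgtP s z.
  - have zt : z < t by exact: lt_le_trans yt.
    by have [/ltW ul /ltW ur] := u_gt0 z sz zt; split => //; exact: sub_I.
  - lra.
  - have xs' : x = s by lra.
    by have [Is us0] := xs xs'; rewrite -sz.
apply: (wronskian_le a b alpha beta1 beta2 u v p q) => //.
- by move=> z xz zy; have [? ? ?] := H z xz zy; apply: jump_uv => //; lra.
- move=> z xz zy; have [Iz ? ?] := H z xz zy.
  by have [|? ?] := v_ge0 z _ Iz; [lra|exact: mulr_ge0].
- move=> z w xz zw wy; apply: (positive_on_incr a b beta1 beta2 I) => //.
  + by apply: in_ab; lra.
  + by apply: in_ab; lra.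
  + move=> r /andP[zr rw].
    by have [||//] := H r; [exact: le_trans (ltW xz) zr|exact: lt_trans rw wy].
Qed.

Let W_right_le : W t <= WR s.
Proof.
apply: cvgr_to_ge (wronskian_cvg_right _ _ _ _ _ _ _ _ _ u_sol v_sol _ sab) _.
apply: filterS (near_nbhs_right _ _ st) => x /andP[sx xt].
by apply: W_le; [lra..|move=> xs; move: sx; rewrite xs ltxx].
Qed.

Let W_left_t : left_lim u t = 0 -> 0 <= W t.
Proof.
move=> ut0; rewrite /W /wronskian_left ut0 mul0r sub0r oppr_ge0.
apply: (mulr_ge0_le0 vtL (ltW _)).
exact: (pos_left_derivative _ _ _ _ alpha_incr omega1_neq0 _ _ _ u_sol u_nontrivial tab ut).
Qed.

Let W_right_s : right_lim u s = 0 -> WR s <= 0.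
Proof.
move=> us0; rewrite /WR /wronskian_right us0 mul0r sub0r oppr_le0.
apply: (mulr_ge0 vsR (ltW _)).
exact: (pos_right_derivative _ _ _ _ alpha_incr omega1_neq0 _ _ _ u_sol u_nontrivial sab us).
Qed.

(* [W] is squeezed between its nonnegative value at [t] and its nonpositive
   limit at [s], so it vanishes and [d(beta1 - beta2)] is null. *)
Lemma no_zero_open : right_lim u s = 0 -> left_lim u t = 0 ->
  nontrivial_on a b (beta1 \- beta2) `]s, t[ -> False.
Proof.
move=> us0 ut0 [c [d [A [win Ast /eqP]]]]; apply.
have Wt := W_left_t ut0; have Ws := W_right_s us0.
have W0 x : s < x -> x < t -> W x = 0.
  move=> sx xt; have xab : oitv a b x by apply: in_ab; lra.
  apply/eqP; rewrite eq_le; apply/andP; split; last first.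
    apply: le_trans Wt _; apply: W_le; [lra..|].
    by move=> xs; move: sx; rewrite xs ltxx.
  apply: le_trans Ws.
  apply: cvgr_to_ge (wronskian_cvg_right _ _ _ _ _ _ _ _ _ u_sol v_sol _ sab) _.
  apply: filterS (near_nbhs_right _ _ sx) => y /andP[sy yx].
  by apply: W_le; [lra..|move=> ys; move: sy; rewrite ys ltxx].
have WR0 x : s < x -> x < t -> WR x = 0.
  move=> sx xt; have xab : oitv a b x by apply: in_ab; lra.
  have := wronskian_cvg_right _ _ _ _ _ _ _ _ _ u_sol v_sol _ xab.
  move/cvg_unique; apply => //; apply: cvg_near_cst.
  by apply: filterS (near_nbhs_right _ _ xt) => y /andP[xy yt]; apply: W0 => //; lra.
(* If a one-sided limit of [v] vanished, [W = 0] and [u > 0] would make the same limit of [q]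
   vanish, against uniqueness. *)
have v_gt0 x : s < x -> x < t -> 0 < left_lim v x /\ 0 < right_lim v x.
  move=> sx xt; have xab : oitv a b x by apply: in_ab; lra.
  have [|vl vr] := v_ge0 x _ (sub_I _ sx xt); first lra.
  have [ul ur] := u_gt0 x sx xt.
  rewrite !lt_neqAle ![0 == _]eq_sym vl vr !andbT; split; apply/eqP => v0.
    have := W0 x sx xt; rewrite /W /wronskian_left v0 mul0r subr0 => /eqP.
    rewrite mulf_eq0 gt_eqF//=; apply/negP.
    exact: (sol_left_neq0 _ _ _ _ _ _ alpha_incr omega2_neq0 v_sol v_nontrivial _ xab).
  have := WR0 x sx xt; rewrite /WR /wronskian_right v0 mul0r subr0 => /eqP.
  rewrite mulf_eq0 gt_eqF//=; apply/negP.
  exact: (sol_right_neq0 _ _ _ _ _ _ alpha_incr omega2_neq0 v_sol v_nontrivial _ xab).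
apply: (stieltjes_eq0 a b _ s t) => //; first exact: bv_locB.
move=> x y sx xy yt.
have [xab yab] : oitv a b x /\ oitv a b y by split; apply: in_ab; lra.
have r1 := bv_loc_regulated _ _ _ beta1_bv; have r2 := bv_loc_regulated _ _ _ beta2_bv.
rewrite (left_limB _ _ _ _ _ r1 r2 xab) (left_limB _ _ _ _ _ r1 r2 yab).
apply/eqP; rewrite eq_le; apply/andP; split.
  apply: (positive_on_incr a b beta1 beta2 I) => // z /andP[xz zy].
  by apply: sub_I; lra.
apply: (wronskian_eq0_const a b alpha beta1 beta2 u v p q) sab tab _ _ _ _ _ sx xy yt => //.
- move=> z sz zt; have zab : oitv a b z by apply: in_ab; lra.
  rewrite (sol_bal u_sol z zab) (sol_bal v_sol z zab).
  have [? ?] := u_gt0 z sz zt; have [? ?] := v_gt0 z sz zt.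
  by rewrite mulr_gt0// divr_gt0// addr_gt0.
- move=> z sz zt.
  by rewrite mulr_gt0 ?(u_gt0 z sz zt).2 ?(v_gt0 z sz zt).2.
Qed.

Let omega_le x : oitv a b x -> I x -> omega alpha beta1 x <= omega alpha beta2 x.
Proof.
move=> xab Ix; have A0 := jump_increasing_ge0 _ _ _ alpha_incr _ xab.
have J := positive_on_jump _ _ _ _ _ beta1_bv beta2_bv pos _ xab Ix.
have := mulr_ge0 A0 J; rewrite /omega; lra.
Qed.

(** Here [W s = - v^- p^-] with [p^- > 0], so [0 <= W t <= W s] forces [v^-(s) = 0]. Then [q^-(s)]
    is positive by [pos_right_crossing] and negative because [v > 0] on the left. The sign of [W t]
    is left open, as it depends on whether [t] is included. *)
Lemma no_zero_left : I s -> left_lim u s = 0 -> 0 < omega alpha beta1 s ->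
  0 <= W t -> False.
Proof.
move=> Is us0 om1 Wt.
have ps : 0 < left_lim p s.
  exact: (pos_right_crossing _ _ _ _ alpha_incr omega1_neq0 _ _ _ u_sol).
have Ws : W t <= W s.
  by apply: (W_le s t (lexx s) (ltW st) (lexx t)); rewrite us0.
have [vsl vsr] := v_pos _ Is.
have vL : 0 <= left_lim v s by exact: (pos_left_ge0 _ _ _ _ (sol_reg v_sol)).
have vs0 : left_lim v s = 0.
  apply/eqP; rewrite eq_le vL andbT -(pmulr_lle0 _ ps) -oppr_ge0.
  by have := le_trans Wt Ws; rewrite /W /wronskian_left us0 mul0r sub0r.
have om2 := lt_le_trans om1 (omega_le _ sab Is).
have := pos_right_crossing _ _ _ _ alpha_incr omega2_neq0 _ _ _ v_sol v_nontrivial sab vsr vs0 om2.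
apply/negP; rewrite -leNgt ltW//.
exact: pos_left_derivative _ _ _ _ alpha_incr omega2_neq0 _ _ _ v_sol v_nontrivial sab vsl vs0.
Qed.

(** At a closed right end the atom at [t] counts, and the known boundary sign is that of [WR t]; the
    jump relation carries it back to [W t]. *)
Let WR_t : I t -> right_lim u t = 0 -> 0 < omega alpha beta1 t ->
  0 <= WR t /\ WR t <= W t.
Proof.
move=> It ut0 om1.
have pt : right_lim p t < 0.
  exact: (pos_left_crossing _ _ _ _ alpha_incr omega1_neq0 _ _ _ u_sol).
have [|vL vR] := v_ge0 t _ It; first by rewrite lexx ltW.
split.
  by rewrite /WR /wronskian_right ut0 mul0r sub0r oppr_ge0 mulr_ge0_le0// ltW.
have := wronskian_jump _ _ _ _ _ _ _ _ _ u_sol v_sol t tab.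
have : 0 <= u t * v t * (jump beta1 t - jump beta2 t).
  by apply: (jump_uv t _ It utL); [rewrite lexx ltW|rewrite ut0].
by rewrite -oppr_le0 => uvJ WJ; rewrite -subr_le0 -/W -/WR in WJ *; rewrite WJ.
Qed.

(** [WR t <= W t <= WR s <= 0], whereas [WR t = - v^+ p^+] with [p^+(t) < 0]. Hence [v^+(t) = 0],
    and [q^+(t)] would be both negative and positive. *)
Lemma no_zero_right : I t -> right_lim u s = 0 -> right_lim u t = 0 ->
  0 < omega alpha beta1 t -> False.
Proof.
move=> It us0 ut0 om1; have [WRt WRW] := WR_t It ut0 om1.
have pt : right_lim p t < 0.
  exact: (pos_left_crossing _ _ _ _ alpha_incr omega1_neq0 _ _ _ u_sol).
have [vtl vtr] := v_pos _ It.
have vR : 0 <= right_lim v t by exact: (pos_right_ge0 _ _ _ _ (sol_reg v_sol)).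
have vt0 : right_lim v t = 0.
  apply/eqP; rewrite eq_le vR andbT -(nmulr_lge0 _ pt) -oppr_le0.
  have := le_trans (le_trans WRW W_right_le) (W_right_s us0).
  by rewrite /WR /wronskian_right ut0 mul0r sub0r.
have om2 := lt_le_trans om1 (omega_le _ tab It).
have := pos_left_crossing _ _ _ _ alpha_incr omega2_neq0 _ _ _ v_sol v_nontrivial tab vtl vt0 om2.
apply/negP; rewrite -leNgt ltW//.
exact: pos_right_derivative _ _ _ _ alpha_incr omega2_neq0 _ _ _ v_sol v_nontrivial tab vtr vt0.
Qed.

Lemma no_zero_co : I s -> left_lim u s = 0 -> left_lim u t = 0 ->
  0 < omega alpha beta1 s -> False.
Proof. by move=> Is us0 ut0 om; exact: (no_zero_left Is us0 om (W_left_t ut0)). Qed.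

Lemma no_zero_cc : I s -> I t -> left_lim u s = 0 -> right_lim u t = 0 ->
  0 < omega alpha beta1 s -> 0 < omega alpha beta1 t -> False.
Proof.
move=> Is It us0 ut0 oms omt; have [WRt WRW] := WR_t It ut0 omt.
exact: (no_zero_left Is us0 oms (le_trans WRt WRW)).
Qed.

End comparison.

Theorem theorem6p2 (R : realType) (a b : \bar R) (ab : (a < b)%E)
    (alpha beta1 beta2 u v : R -> R)
    (alpha_incr : forall x y, oitv a b x -> oitv a b y -> x < y ->
       alpha x < alpha y)
    (beta1_bv : bv_loc a b beta1) (beta2_bv : bv_loc a b beta2)
    (omega1_neq0 : forall x, oitv a b x -> omega alpha beta1 x != 0)
    (omega2_neq0 : forall x, oitv a b x -> omega alpha beta2 x != 0)
    (u_sol : real_balanced_solution a b alpha beta1 u)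
    (u_nontrivial : nontrivial a b u)
    (v_sol : real_balanced_solution a b alpha beta2 v)
    (v_nontrivial : nontrivial a b v)
    (s t : R) (st : consecutive_zeros a b u s t) :
  [/\ (right_lim u s = 0 -> left_lim u t = 0 ->
       positive_on a b (beta1 \- beta2) `]s, t[ ->
       nontrivial_on a b (beta1 \- beta2) `]s, t[ ->
       changes_sign_in a b v `]s, t[),
      (left_lim u s = 0 -> left_lim u t = 0 ->
       0 < omega alpha beta1 s ->
       positive_on a b (beta1 \- beta2) `[s, t[ ->
       changes_sign_in a b v `[s, t[),
      (right_lim u s = 0 -> right_lim u t = 0 ->
       0 < omega alpha beta1 t ->
       positive_on a b (beta1 \- beta2) `]s, t] ->
       changes_sign_in a b v `]s, t])
    & (left_lim u s = 0 -> right_lim u t = 0 ->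
       0 < omega alpha beta1 s -> 0 < omega alpha beta1 t ->
       positive_on a b (beta1 \- beta2) `[s, t] ->
       changes_sign_in a b v `[s, t])].
Proof.
have [p psol] := real_balanced_solutionP _ _ _ _ _ alpha_incr beta1_bv u_sol.
have [q qsol] := real_balanced_solutionP _ _ _ _ _ alpha_incr beta2_bv v_sol.
have [st0 [sab _] [tab _] Z0] := st.
have sub x : s <= x <= t -> oitv a b x by exact: (oitv_cc _ _ _ _ _ sab tab).
have uLR x : s < x -> x < t -> 0 < left_lim u x * right_lim u x.
  move=> sx xt; rewrite ltNge; apply/negP => u0.
  have : (zero_set (oitv a b) u `&` `]s, t[) x.
    by split; [split => //; apply: sub; lra|rewrite /= in_itv/= sx].
  by rewrite Z0.
have ru := sol_reg psol.
(* The equation is linear, so [u] may be replaced by [- u] to be positive between the two zeros. *)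
have u_sign : exists u' p', [/\ solution a b alpha beta1 u' p', nontrivial a b u',
    u' = u \/ u' = \- u & forall x, s < x -> x < t -> pos_left u' x /\ pos_right u' x].
  have [|||H|H] := sign_const _ _ _ _ alpha_incr omega1_neq0 _ _ `]s, t[ psol u_nontrivial.
  - by move=> x; rewrite /= in_itv/= => /andP[sx xt]; apply: sub; lra.
  - exact: interval_is_interval.
  (* A sign change at [x] would give [u^- u^+ <= 0] in the limit, that is, a zero strictly between
     consecutive ones. *)
  - move=> x; rewrite /= in_itv/= => /andP[sx xt] [xab [e e0 [_ H]]].
    have := uLR x sx xt; apply/negP; rewrite -leNgt.
    have ex : x - e < x by lra.
    have xe : x < x + e by lra.
    have cvL := left_lim_cvg_left _ _ _ ru _ xab.
    have cvR : right_lim u y @[y --> x^'+] --> right_lim u x.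
      apply/cvgrPdistC_le => r r0.
      by apply: filterS (regulated_near_right _ _ _ ru _ _ xab r0) => z [].
    case: H => -[HL HR].
    + rewrite mulr_le0_ge0//.
        apply: cvgr_to_le cvL _; apply: filterS (near_nbhs_left _ _ ex) => y xy.
        exact/ltW/HL.
      apply: cvgr_to_ge cvR _; apply: filterS (near_nbhs_right _ _ xe) => y xy.
      exact/ltW/HR.
    + rewrite mulr_ge0_le0//.
        apply: cvgr_to_ge cvL _; apply: filterS (near_nbhs_left _ _ ex) => y xy.
        exact/ltW/HL.
      apply: cvgr_to_le cvR _; apply: filterS (near_nbhs_right _ _ xe) => y xy.
      exact/ltW/HR.
  - exists u, p; split => //; first by left.
    by move=> x sx xt; apply: H; rewrite /= in_itv/= sx.
  - exists (\- u), (\- p); split; [exact: solutionN|exact: nontrivialN|by right|].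
    by move=> x sx xt; apply: H; rewrite /= in_itv/= sx.
have [u' [p' [sol' nt' u'E u'pos]]] := u_sign.
have u'L x : oitv a b x -> left_lim u x = 0 -> left_lim u' x = 0.
  by move=> xab u0; case: u'E => -> //; rewrite (left_limN a b)// u0 oppr0.
have u'R x : oitv a b x -> right_lim u x = 0 -> right_lim u' x = 0.
  by move=> xab u0; case: u'E => -> //; rewrite (right_limN a b)// u0 oppr0.
have u'LR x : s < x -> x < t -> 0 < left_lim u' x * right_lim u' x.
  move=> sx xt; have xab : oitv a b x by apply: sub; lra.
  case: u'E => ->; first exact: uLR.
  by rewrite (left_limN a b)// (right_limN a b)// mulrNN; exact: uLR.
have v_sign (I : set R) : (forall x, I x -> s <= x <= t) ->
    is_interval I -> ~ changes_sign_in a b v I -> exists v' q', [/\ solution a b alpha beta2 v' q',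
    nontrivial a b v' & forall x, I x -> pos_left v' x /\ pos_right v' x].
  move=> Ist Icvx ncs.
  have [|||H|H] := sign_const _ _ _ _ alpha_incr omega2_neq0 _ _ I qsol v_nontrivial.
  - by move=> x /Ist/sub.
  - exact: Icvx.
  - by move=> x Ix cs; apply: ncs; exists x.
  - by exists v, q.
  - by exists (\- v), (\- q); split => //; [exact: solutionN|exact: nontrivialN].
split.
- move=> us ut pos nz; apply: contrapT => /v_sign[||v' [q' [vsol vnt vpos]]].
  + by move=> x /=; rewrite in_itv/= => /andP[? ?]; lra.
  + exact: interval_is_interval.
  apply: (no_zero_open a b alpha beta1 beta2 u' v' p' q' `]s, t[ alpha_incr beta1_bv beta2_bv
    omega1_neq0 omega2_neq0 sol' vsol nt' vnt pos s t sab tab st0) => //.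
  + by move=> x sx xt; rewrite /= in_itv/= sx.
  + exact: u'R.
  + exact: u'L.
- move=> us ut om pos; apply: contrapT => /v_sign[||v' [q' [vsol vnt vpos]]].
  + by move=> x /=; rewrite in_itv/= => /andP[? ?]; lra.
  + exact: interval_is_interval.
  apply: (no_zero_co a b alpha beta1 beta2 u' v' p' q' `[s, t[ alpha_incr beta1_bv beta2_bv
    omega1_neq0 omega2_neq0 sol' vsol nt' vnt pos s t sab tab st0) => //.
  + by move=> x sx xt; rewrite /= in_itv/= (ltW sx).
  + by rewrite /= in_itv/= lexx.
  + exact: u'L.
  + exact: u'L.
- move=> us ut om pos; apply: contrapT => /v_sign[||v' [q' [vsol vnt vpos]]].
  + by move=> x /=; rewrite in_itv/= => /andP[? ?]; lra.
  + exact: interval_is_interval.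
  apply: (no_zero_right a b alpha beta1 beta2 u' v' p' q' `]s, t] alpha_incr beta1_bv beta2_bv
    omega1_neq0 omega2_neq0 sol' vsol nt' vnt pos s t sab tab st0) => //.
  + by move=> x sx xt; rewrite /= in_itv/= sx ltW.
  + by rewrite /= in_itv/= lexx andbT.
  + exact: u'R.
  + exact: u'R.
- move=> us ut om om' pos; apply: contrapT => /v_sign[||v' [q' [vsol vnt vpos]]].
  + by move=> x /=; rewrite in_itv/=.
  + exact: interval_is_interval.
  apply: (no_zero_cc a b alpha beta1 beta2 u' v' p' q' `[s, t] alpha_incr beta1_bv beta2_bv
    omega1_neq0 omega2_neq0 sol' vsol nt' vnt pos s t sab tab st0) => //.
  + by move=> x sx xt; rewrite /= in_itv/= !ltW.
  + by rewrite /= in_itv/= lexx ltW.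
  + by rewrite /= in_itv/= lexx ltW.
  + exact: u'L.
  + exact: u'R.
Qed.
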